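(* There exist a compact plane set $X$ and four compact plane sets $X_1, X_2, X_3, X_4$ such that $X=\bigcup_{k=1}^{4} X_k$ and $R(X_k)$ is regular for each $k\in\{1,2,3,4\}$, but $R(X)$ is not regular.
   Context: A compact plane set is a non-empty compact subset of $\mathbb{C}$. For a compact plane set $X$, $C(X)$ is the algebra of continuous complex-valued functions on $X$ with the uniform norm, and $R(X)$ is the set of those $f\in C(X)$ which can be uniformly approximated on $X$ by rational functions with no poles on $X$. $R(X)$ is a uniform algebra on $X$ (a closed subalgebra of $C(X)$ that contains the constants and separates the points of $X$), and it is natural: its character space is $X$, with points identified with evaluation functionals. $R(X)$ is called regular if, for every closed subset $F$ of $X$ and every $y\in X\setminus F$, there exists $f\in R(X)$ with $f(y)=1$ and $f(F)\subseteq\{0\}$. *)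

(* Defs.v *)
From HB Require Import structures.
From mathcomp Require Import all_boot all_order all_algebra.
From mathcomp Require Import boolp classical_sets functions reals topology.
From mathcomp Require Import normedtype.
From mathcomp Require Import complex.

Set Implicit Arguments.
Unset Strict Implicit.
Unset Printing Implicit Defensive.

Import Order.TTheory GRing.Theory Num.Theory.
Import numFieldNormedType.Exports.

Local Open Scope classical_set_scope.
Local Open Scope ring_scope.
Local Open Scope complex_scope.

(* The complex plane is R[i] for R : realType, with the topology given by its
   norm as a numFieldType; that norm is R[i]-valued, so real bounds are embedded
   by %:C. *)
HB.instance Definition _ (R : rcfType) := NormedModule.copy R[i] R[i]^o.

Definition compact_plane_set (R : realType) (X : set R[i]) : Prop :=
  X !=set0 /\ compact X.

(* Functions on X are represented by total functions R[i] -> R[i]; every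
   predicate below depends only on their values on X. *)

(* A rational function has no poles on X iff it can be written p / q with q
   having no zeros on X (e.g., in lowest terms). *)
Definition rational_on (R : realType) (X : set R[i]) : set (R[i] -> R[i]) :=
  [set r | exists p q : {poly R[i]},
     forall z, X z -> ~~ root q z /\ r z = p.[z] / q.[z]].

Definition RX (R : realType) (X : set R[i]) : set (R[i] -> R[i]) :=
  [set f | {within X, continuous f} /\
     forall e : R, 0 < e ->
       exists2 r, rational_on X r & forall z, X z -> `|f z - r z| < e%:C].

(* X is intended to be compact, so that the relatively closed subsets of X are
   the closed sets of the plane that are contained in X. *)
Definition regular_on (R : realType) (X : set R[i])
    (A : set (R[i] -> R[i])) : Prop :=
  forall (F : set R[i]) (y : R[i]), closed F -> F `<=` X -> (X `\` F) y ->
    exists2 f, A f & f y = 1 /\ f @` F `<=` [set 0].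

(* Main.v *)
(** Let X be the disc |z| <= 4 with holes removed, the holes being off the real
    axis.  Around each disc with rational centre and radius whose double misses
    the real axis we remove a McKissick family of holes (in Körner's form:
    f = prod_k 1 / (1 - (z / rho_k)^N_k), with holes around the poles), so that
    R(X) contains functions supported in arbitrarily small discs around any
    point off the real axis.  The holes of the j-th family have distance at
    least D_j to the real axis and radii with sum eps_j, so small compared with
    D_j that the following quantitative analytic continuation holds.  By
    Cauchy's formula, f in R(X) is on [0,1] within O(sum_(j > m) eps_j / D_j) of
    a bounded superposition of kernels 1 / (w - z) with w at distance at least
    D_m / 4 from [0,1]; for those kernels, evaluation at 1 is a limit, uniform
    in w, of combinations of evaluations at points of [0,1/2].  The
    coefficients depend on D_m only, and eps_j is chosen after them.  Hence
    f = 0 on [0,1/2] forces f(1) = 0, and R(X) is not regular.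

    The upper and lower half planes are paved by Whitney squares of the real
    axis, coloured with four colours so that squares of the same colour are
    separated by gaps comparable to their size; X_k is the part of X in the
    k-th colour and the real axis.  On X_k the indicator function of a square
    is a limit of 1 / (1 - ((z - c) / r)^N), so a hat function on the real
    axis, continued by constants on the squares, lies in R(X_k); this gives
    regularity at the real points, and X_k inherits regularity from X at the
    others. *)

Require Import Defs.
From mathcomp Require Import all_boot all_order all_algebra.
From mathcomp Require Import boolp classical_sets functions reals topology.
From mathcomp Require Import normedtype.
From mathcomp Require Import complex.
From mathcomp Require Import separable cyclotomic cyclic ring lra zify.
Set Implicit Arguments.
Unset Strict Implicit.
Unset Printing Implicit Defensive.
Import Order.TTheory GRing.Theory Num.Theory.
Import numFieldNormedType.Exports.
Local Open Scope classical_set_scope.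
Local Open Scope ring_scope.
Local Open Scope complex_scope.

Local Notation Re := complex.Re.
Local Notation Im := complex.Im.

(** * The modulus of a complex number *)

Section Modulus.
Variable R : realType.
Implicit Types z w : R[i].

Definition mag z : R := Num.sqrt (Re z ^+ 2 + Im z ^+ 2).

Lemma normE z : `|z| = (mag z)%:C.
Proof. by rewrite normc_def. Qed.

Lemma mag_ge0 z : 0 <= mag z.
Proof. exact: sqrtr_ge0. Qed.

Lemma magM : {morph mag : z w / z * w}.
Proof. by move=> z w; apply: complexI; rewrite -normE normrM !normE rmorphM. Qed.

Lemma magC (r : R) : mag r%:C = `|r|.
Proof. by rewrite /mag /= expr0n addr0 sqrtr_sqr. Qed.

Lemma mag0 : mag 0 = 0.
Proof. by rewrite -(rmorph0 (real_complex R)) magC normr0. Qed.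

Lemma mag1 : mag 1 = 1.
Proof. by rewrite -(rmorph1 (real_complex R)) magC normr1. Qed.

Lemma magN z : mag (- z) = mag z.
Proof. by apply: complexI; rewrite -!normE normrN. Qed.

Lemma magV z : mag z^-1 = (mag z)^-1.
Proof. by apply: complexI; rewrite -normE normfV normE fmorphV. Qed.

Lemma mag_div z w : mag (z / w) = mag z / mag w.
Proof. by rewrite magM magV. Qed.

Lemma magX z n : mag (z ^+ n) = mag z ^+ n.
Proof. by apply: complexI; rewrite -normE normrX normE rmorphXn. Qed.

Lemma mag_nat n : mag n%:R = n%:R.
Proof. by apply: complexI; rewrite -normE normr_nat rmorph_nat. Qed.

Lemma mag_eq0 z : (mag z == 0) = (z == 0).
Proof.
rewrite -[RHS]normr_eq0 normE -(rmorph0 (real_complex R)).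
by rewrite (inj_eq (@complexI R)).
Qed.

Lemma mag_gt0 z : (0 < mag z) = (z != 0).
Proof. by rewrite lt_neqAle mag_ge0 andbT eq_sym mag_eq0. Qed.

Lemma magD z w : mag (z + w) <= mag z + mag w.
Proof. by rewrite -lecR rmorphD /= -!normE ler_normD. Qed.

Lemma mag_distC z w : mag (z - w) = mag (w - z).
Proof. by rewrite -magN opprB. Qed.

Lemma magB z w : mag (z - w) <= mag z + mag w.
Proof. by rewrite -[mag w]magN magD. Qed.

Lemma mag_triang y z w : mag (z - w) <= mag (z - y) + mag (y - w).
Proof. by rewrite -[z - w](subrKA y) magD. Qed.

Lemma mag_sub_le z w : mag z - mag w <= mag (z - w).
Proof. by have := magD (z - w) w; rewrite subrK; lra. Qed.

Lemma mag_sum (I : Type) (s : seq I) (P : pred I) (F : I -> R[i]) :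
  mag (\sum_(i <- s | P i) F i) <= \sum_(i <- s | P i) mag (F i).
Proof.
elim/big_rec2: _ => [|i x y _ h]; first by rewrite mag0.
by apply: le_trans (magD _ _) _; rewrite lerD2l.
Qed.

Lemma mag_prod (I : Type) (s : seq I) (P : pred I) (F : I -> R[i]) :
  mag (\prod_(i <- s | P i) F i) = \prod_(i <- s | P i) mag (F i).
Proof. by apply: (big_morph mag magM mag1). Qed.

Lemma Re_le_mag z : `|Re z| <= mag z.
Proof. by rewrite -sqrtr_sqr ler_wsqrtr // lerDl sqr_ge0. Qed.

Lemma Im_le_mag z : `|Im z| <= mag z.
Proof. by rewrite -sqrtr_sqr ler_wsqrtr // lerDr sqr_ge0. Qed.

Lemma mag_le_ReIm z : mag z <= `|Re z| + `|Im z|.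
Proof.
rewrite -[X in _ <= X]ger0_norm ?addr_ge0 // -sqrtr_sqr ler_wsqrtr //.
rewrite sqrrD !real_normK ?num_real // -addrA [X in _ <= _ + X]addrC addrA lerDl.
by rewrite mulrn_wge0 // mulr_ge0.
Qed.

Lemma mag_sqr z : mag z ^+ 2 = Re z ^+ 2 + Im z ^+ 2.
Proof. by rewrite sqr_sqrtr // addr_ge0 // sqr_ge0. Qed.

Lemma ReB z w : Re (z - w) = Re z - Re w. Proof. by case: z w => a b [c d]. Qed.
Lemma ImB z w : Im (z - w) = Im z - Im w. Proof. by case: z w => a b [c d]. Qed.

End Modulus.

(** * The factors 1 / (1 - w^N) *)

Section GeometricFactor.
Variable R : realType.
Implicit Types u v w z : R[i].

(** With s = 1 - t this reads (1 - s)^n <= 1 / (1 + n s); the induction rests on (1 - s) (1 + (n +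
    1) s) <= 1 + n s. *)
Lemma bernoulli_expr (t : R) n : 0 <= t <= 1 -> t ^+ n * (1 + n%:R * (1 - t)) <= 1.
Proof.
case/andP=> t0 t1; elim: n => [|n IH]; first by rewrite expr0 mul0r addr0 mulr1.
apply: le_trans IH; rewrite exprSr -mulrA ler_wpM2l ?exprn_ge0 // -natr1.
have n0 : 0 <= n%:R :> R by [].
have : 0 <= n%:R * (1 - t) * (1 - t) ^+ 2 by rewrite !mulr_ge0 ?sqr_ge0 ?subr_ge0.
by have := mulr_ge0 n0 (mulr_ge0 (sqr_ge0 (1 - t)) t0); nra.
Qed.

Lemma expr_small (t e : R) : 0 <= t < 1 -> 0 < e ->
  exists N, forall n, (N <= n)%N -> t ^+ n <= e.
Proof.
case/andP=> t0 t1 e0.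
pose x := e^-1 / (1 - t); exists (Num.bound x) => n Nn.
have d0 : 0 < 1 - t by rewrite subr_gt0.
have xn : x <= n%:R.
  apply: ltW; apply: le_lt_trans (ler_norm _) _.
  by apply: lt_le_trans (archi_boundP (normr_ge0 _)) _; rewrite ger0_norm ?ler_nat //
    divr_ge0 ?invr_ge0 ?ltW.
have : t ^+ n * (1 + n%:R * (1 - t)) <= 1 by apply: bernoulli_expr; rewrite t0 ltW.
have : e^-1 <= n%:R * (1 - t) by rewrite -ler_pdivrMr.
move=> h1 h2; have tn : 0 <= t ^+ n by rewrite exprn_ge0.
rewrite -[e]invrK -div1r ler_pdivlMr ?invr_gt0 //; apply: le_trans h2.
by rewrite ler_wpM2l //; lra.
Qed.

(** The factor is nearly 1 well inside the unit circle and, by [gfac_near0], nearly 0 well outside,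
    so it approximates the indicator function of a disc. *)
Lemma gfac_near1 w n : mag w ^+ n <= 1 / 2 ->
  1 - w ^+ n != 0 /\ mag ((1 - w ^+ n)^-1 - 1) <= 2 * mag w ^+ n.
Proof.
move=> h; have m2 : 1 / 2 <= mag (1 - w ^+ n).
  by have := mag_sub_le 1 (w ^+ n); rewrite mag1 magX; lra.
have n0 : 1 - w ^+ n != 0 by rewrite -mag_gt0; lra.
split=> //; have -> : (1 - w ^+ n)^-1 - 1 = w ^+ n / (1 - w ^+ n) by field.
rewrite mag_div magX ler_pdivrMr; last by lra.
have : 0 <= mag w ^+ n by rewrite exprn_ge0 ?mag_ge0.
by nra.
Qed.

Lemma gfac_near0 w n : 2 <= mag w ^+ n ->
  1 - w ^+ n != 0 /\ mag (1 - w ^+ n)^-1 <= 2 * (mag w ^+ n)^-1.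
Proof.
move=> h; have m2 : mag w ^+ n / 2 <= mag (1 - w ^+ n).
  by have := mag_sub_le (w ^+ n) 1; rewrite mag_distC mag1 magX; lra.
have n0 : 1 - w ^+ n != 0 by rewrite -mag_gt0; lra.
split=> //; rewrite magV -[2]invrK -invfM lef_pV2 ?posrE; lra.
Qed.

(* Square root close to [1]: of the two roots take the one nearer to [1], so
   that [|u + 1| >= 2 - |u - 1|]. *)
Lemma sqrt_near1 v : mag (v - 1) < 1 ->
  exists2 u, u ^+ 2 = v & mag (u - 1) < 1 /\ 1 - mag (v - 1) <= (1 - mag (u - 1)) ^+ 2.
Proof.
move=> h.
have [u uv ule] : exists2 u, u ^+ 2 = v & mag (u - 1) <= mag (u + 1).
  case: (lerP (mag (sqrtc v - 1)) (mag (sqrtc v + 1))) => ?.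
    by exists (sqrtc v); rewrite ?sqr_sqrtc.
  exists (- sqrtc v); rewrite ?sqrrN ?sqr_sqrtc //.
  by rewrite -opprD magN [_ + 1]addrC mag_distC ltW.
exists u => //.
have e : mag (v - 1) = mag (u - 1) * mag (u + 1).
  by rewrite -magM -uv; congr mag; ring.
have h2 : 2 - mag (u - 1) <= mag (u + 1).
  have := magB (u + 1) (u - 1); rewrite (_ : u + 1 - (u - 1) = 2%:R); last by ring.
  by rewrite mag_nat; lra.
have := mag_ge0 (u - 1).
move: (mag (u - 1)) (mag (u + 1)) (mag (v - 1)) e h ule h2 => a b c -> hc ab b2 a0.
by split; nra.
Qed.

(** Iterated square roots: the bounds of [sqrt_near1] compose to a power 2^m. This is why the
    exponents below are powers of two. *)
Lemma root_near1 m v : mag (v - 1) < 1 ->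
  exists2 u, u ^+ (2 ^ m) = v &
    mag (u - 1) < 1 /\ 1 - mag (v - 1) <= (1 - mag (u - 1)) ^+ (2 ^ m).
Proof.
elim: m v => [|m IH] v h; first by exists v; rewrite ?expr1.
have [u uv [u1 hu]] := sqrt_near1 h; have [x xu [x1 hx]] := IH _ u1.
exists x; first by rewrite expnSr exprM xu.
split=> //; apply: le_trans hu _; rewrite expnSr exprM.
by rewrite ler_pXn2r // nnegrE ?exprn_ge0 // subr_ge0 ltW.
Qed.

(* The loss [2 / d] does not depend on the exponent. *)
Lemma gfac_bound m (d : R) w : 0 < d <= 1 ->
  (forall x : R[i], x ^+ (2 ^ m) = 1 -> d / (2 ^ m)%:R <= mag (w - x)) ->
  1 - w ^+ (2 ^ m) != 0 /\ mag (1 - w ^+ (2 ^ m))^-1 <= 2 / d.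
Proof.
case/andP=> d0 d1 h; set N := (2 ^ m)%N in h *.
have N0 : 0 < N%:R :> R by rewrite ltr0n expn_gt0.
suff m2 : d / 2 <= mag (1 - w ^+ N).
  have p : 0 < mag (1 - w ^+ N) by lra.
  split; first by rewrite -mag_gt0.
  by rewrite magV -[2 / d]invf_div lef_pV2 ?posrE //; lra.
rewrite leNgt; apply/negP => lt.
rewrite mag_distC in lt.
(* If w^N is within d / 2 of 1, it has an N-th root u near 1, and Bernoulli gives N |u - 1| < d.
   Then w / u is an N-th root of unity at distance |u - 1| < d / N from w. *)
have [|u uN [u1 hu]] := @root_near1 m (w ^+ N) _; first by lra.
rewrite -/N in uN hu.
set a := mag (u - 1) in u1 hu; set b := mag _ in lt hu.
have a0 : 0 <= a := mag_ge0 _.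
have := @bernoulli_expr (1 - a) N _; rewrite opprB addrCA subrr addr0 => /(_ _) H.
have {}H : (1 - a) ^+ N * (1 + N%:R * a) <= 1 by apply: H; rewrite gerBl subr_ge0 ltW.
have Na0 : 0 <= N%:R * a by rewrite mulr_ge0.
have H2 : (1 - b) * (1 + N%:R * a) <= 1.
  by apply: le_trans H; rewrite ler_wpM2r // addr_ge0.
have b0 : 0 <= b := mag_ge0 _.
have Nd : N%:R * a < d by move: (N%:R * a) Na0 H2 => y y0; nra.
have u0 : u != 0.
  by apply/eqP => u0; move: u1; rewrite /a u0 sub0r magN mag1 ltxx.
have x1 : (w / u) ^+ N = 1 by rewrite expr_div_n uN divff // -uN expf_neq0.
have mx : mag (w / u) = 1.
  have Np : (0 < N)%N by rewrite expn_gt0.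
  by apply/eqP; rewrite -(pexpr_eq1 Np (mag_ge0 _)) -magX x1 mag1.
have := h _ x1; rewrite (_ : w - w / u = w / u * (u - 1)); last by field.
by rewrite magM mx mul1r -/a ler_pdivrMr // mulrC leNgt Nd.
Qed.

End GeometricFactor.

(** * Topology of the plane *)

Section PlaneTopology.
Variable R : realType.
Implicit Types (z w : R[i]) (X : set R[i]).

Lemma nbhs_magP z (A : set R[i]) :
  nbhs z A <-> exists2 e : R, 0 < e & forall w, mag (w - z) < e -> A w.
Proof.
split=> [/nbhs_ballP [e /= e0 eA]|[e e0 eA]].
  (* A positive element of [R[i]] has imaginary part 0. *)
  move: e0 eA; case: e => a b; rewrite ltcE /= => /andP [/eqP -> a0] eA.
  exists a => // w wa; apply: eA; rewrite -ball_normE /=.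
  by rewrite distrC normE ltcR.
apply/nbhs_ballP; exists e%:C; first by rewrite /= ltcR.
by move=> w; rewrite -ball_normE /= distrC normE ltcR; exact: eA.
Qed.

Lemma mag_dist_le z w : `|mag z - mag w| <= mag (z - w).
Proof.
have h1 := mag_sub_le z w; have := mag_sub_le w z; rewrite mag_distC => h2.
by rewrite ler_norml; apply/andP; split; lra.
Qed.

Lemma continuous_at_mag (f : R[i] -> R) z :
  (forall w, `|f w - f z| <= mag (w - z)) -> f w @[w --> z] --> f z.
Proof.
move=> h A /nbhs_ballP [e /= e0 eA]; apply/nbhs_magP; exists e => // w wz.
by apply: eA; rewrite /ball /= distrC; apply: le_lt_trans wz; exact: h.
Qed.

(** Bound and Lipschitz constant are proved together because the induction step from p to p X + c
    uses both. *)
Lemma horner_lipschitz (p : {poly R[i]}) (r : R) : 0 <= r ->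
  exists2 L : R, 0 <= L & forall z w, mag z <= r -> mag w <= r ->
    mag p.[z] <= L /\ mag (p.[w] - p.[z]) <= L * mag (w - z).
Proof.
move=> r0; elim/poly_ind: p => [|p c [L L0 IH]].
  by exists 0 => // z w _ _; rewrite !horner0 subrr mag0 mul0r.
have c0 := mag_ge0 c.
exists (L * r + L + mag c); first by rewrite !addr_ge0 ?mulr_ge0.
move=> z w zr wr; have [pz pwz] := IH z w zr wr; rewrite !hornerMXaddC.
have Lr : L * r >= 0 by rewrite mulr_ge0.
have Lz : mag p.[z] * mag z <= L * r by rewrite ler_pM ?mag_ge0.
split; first by apply: le_trans (magD _ _) _; rewrite magM; lra.
rewrite (_ : _ - _ = (p.[w] - p.[z]) * w + p.[z] * (w - z)); last by ring.
apply: le_trans (magD _ _) _; rewrite !magM.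
have d0 := mag_ge0 (w - z).
have h1 : mag (p.[w] - p.[z]) * mag w <= L * mag (w - z) * r.
  by rewrite ler_pM ?mag_ge0.
have h2 : mag p.[z] * mag (w - z) <= L * mag (w - z) by rewrite ler_wpM2r.
have h3 : 0 <= mag c * mag (w - z) by rewrite mulr_ge0.
by nra.
Qed.

Lemma horner_eps_delta (p : {poly R[i]}) z (e : R) : 0 < e ->
  exists2 d : R, 0 < d & forall w, mag (w - z) < d -> mag (p.[w] - p.[z]) < e.
Proof.
move=> e0; have z0 := mag_ge0 z.
have [L L0 H] := @horner_lipschitz p (mag z + 1) ltac:(lra).
exists (Num.min 1 (e / (L + 1))); first by rewrite lt_min ltr01 divr_gt0 ?ltr_wpDl.
move=> w; rewrite lt_min => /andP [w1 we].
have wz : mag w <= mag z + 1 by have := mag_sub_le w z; lra.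
have [_ h] := H z w ltac:(lra) wz; apply: le_lt_trans h _.
rewrite ltr_pdivlMr ?ltr_wpDl // in we.
by have := mag_ge0 (w - z); nra.
Qed.

Lemma mag_horner_continuous (p : {poly R[i]}) : continuous (fun z => mag p.[z]).
Proof.
move=> z A /nbhs_ballP [e /= e0 eA]; apply/nbhs_magP.
have [d d0 H] := horner_eps_delta p z e0; exists d => // w /H h.
apply: eA; rewrite /ball /= distrC; apply: le_lt_trans h; exact: mag_dist_le.
Qed.

Lemma closed_mag_le c (r : R) : closed [set z | mag (z - c) <= r].
Proof.
rewrite (_ : [set z | _] = (fun z => mag ('X - c%:P).[z]) @^-1` [set x | x <= r]).
  by apply: preimage_closed; [move=> z _; exact: mag_horner_continuous|exact: closed_le].
by apply/seteqP; split=> z /=; rewrite hornerXsubC.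
Qed.

Lemma closed_mag_ge c (r : R) : closed [set z | r <= mag (z - c)].
Proof.
rewrite (_ : [set z | _] = (fun z => mag ('X - c%:P).[z]) @^-1` [set x | r <= x]).
  by apply: preimage_closed; [move=> z _; exact: mag_horner_continuous|exact: closed_ge].
by apply/seteqP; split=> z /=; rewrite hornerXsubC.
Qed.

Lemma Re_continuous : continuous (@complex.Re R).
Proof.
by move=> z; apply: continuous_at_mag => w; rewrite -ReB Re_le_mag.
Qed.

Lemma Im_continuous : continuous (@complex.Im R).
Proof.
by move=> z; apply: continuous_at_mag => w; rewrite -ImB Im_le_mag.
Qed.

Lemma compact_disc (c : R) : compact [set z : R[i] | mag z <= c].
Proof.
pose f (x : R * R) : R[i] := x.1 +i* x.2.
apply: (@subclosed_compact _ _ (f @` (`[- c, c] `*` `[- c, c]))).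
- rewrite (_ : [set z | _] = [set z | mag (z - 0) <= c]); first exact: closed_mag_le.
  by apply/seteqP; split=> z /=; rewrite subr0.
- apply: continuous_compact; last by apply: compact_setX; exact: segment_compact.
  apply: continuous_subspaceT => -[a b] A /nbhs_magP [e e0 eA].
  exists (ball a (e / 2), ball b (e / 2)).
    by split; apply/nbhs_ballP; exists (e / 2) => //=; rewrite divr_gt0.
  move=> [x y] /= [xa yb]; apply: eA; apply: le_lt_trans (mag_le_ReIm _) _ => /=.
  by rewrite /ball /= in xa yb; rewrite distrC [`|y - b|]distrC; lra.
- move=> z /= zc; exists (Re z, Im z); last by case: z zc.
  by split; rewrite /= in_itv /= -ler_norml; apply: le_trans zc;
    rewrite ?Re_le_mag ?Im_le_mag.
Qed.

End PlaneTopology.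

(** * Uniform approximation by rational functions *)

Section RationalApproximation.
Variable R : realType.
Implicit Types (z w : R[i]) (X : set R[i]) (p q : {poly R[i]}) (f g : R[i] -> R[i]).

(** The approximation clause of [RX] in terms of the real modulus; by [rat_approx_RX] and
    [RX_rat_approx] it is equivalent to membership in [RX X]. *)
Definition rat_approx X f := forall e : R, 0 < e ->
  exists p q, forall z, X z -> q.[z] != 0 /\ mag (f z - p.[z] / q.[z]) < e.

Lemma ratio_eps_delta p q z (e : R) : q.[z] != 0 -> 0 < e ->
  exists2 d : R, 0 < d &
    forall w, mag (w - z) < d -> mag (p.[w] / q.[w] - p.[z] / q.[z]) < e.
Proof.
move=> qz e0; set a := mag q.[z]; set b := mag p.[z].
have a0 : 0 < a by rewrite mag_gt0.
have b0 : 0 <= b := mag_ge0 _.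
have ea : 0 < e * a / 4 by rewrite divr_gt0 ?mulr_gt0.
have [d1 d10 H1] := horner_eps_delta p z ea.
have m0 : 0 < Num.min (a / 2) (e * a ^+ 2 / (4 * (b + 1))).
  by rewrite lt_min !divr_gt0 ?mulr_gt0 ?exprn_gt0 ?ltr_wpDl.
have [d2 d20 H2] := horner_eps_delta q z m0.
exists (Num.min d1 d2); first by rewrite lt_min d10.
move=> w; rewrite lt_min => /andP [/H1 h1 /H2]; rewrite lt_min => /andP [h2 h3].
have qw : a / 2 <= mag q.[w].
  by have := mag_sub_le q.[z] q.[w]; rewrite mag_distC -/a; lra.
have qw0 : q.[w] != 0 by rewrite -mag_gt0; lra.
rewrite (_ : _ - _ = ((p.[w] - p.[z]) * q.[z] - p.[z] * (q.[w] - q.[z])) /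
   (q.[w] * q.[z])); last by field; rewrite ?qz ?qw0.
rewrite mag_div magM -/a ltr_pdivrMr; last by rewrite mulr_gt0 //; lra.
apply: le_lt_trans (magB _ _) _; rewrite !magM -/a -/b.
have h4 : b * mag (q.[w] - q.[z]) <= e * a ^+ 2 / 4.
  rewrite ltr_pdivlMr in h3; last by lra.
  have := mag_ge0 (q.[w] - q.[z]); move: (mag _) h3 => x h3 x0.
  by move: (e * a ^+ 2) h3 => y h3; nra.
have h5 : mag (p.[w] - p.[z]) * a < e * a ^+ 2 / 4.
  have -> : e * a ^+ 2 / 4 = (e * a / 4) * a by ring.
  by rewrite ltr_pM2r.
have h6 : e * a ^+ 2 / 2 <= e * (mag q.[w] * a).
  have -> : e * a ^+ 2 / 2 = e * (a / 2 * a) by ring.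
  by rewrite ler_wpM2l ?ler_wpM2r // ltW.
lra.
Qed.

Lemma rat_approx_RX X f : rat_approx X f -> RX X f.
Proof.
move=> H; split; last first.
  move=> e /H [p [q pq]]; exists (fun z => p.[z] / q.[z]).
    by exists p, q => z /pq [? _].
  by move=> z /pq [_ ?]; rewrite normE ltcR.
apply/subspace_continuousP => x Xx A /nbhs_magP [e e0 eA].
have e3 : 0 < e / 3 by rewrite divr_gt0.
have [p [q pq]] := H _ e3; have [qx fx] := pq x Xx.
have [d d0 Hd] := ratio_eps_delta p qx e3.
rewrite /nbhs /= /within; apply/nbhs_magP; exists d => // w /Hd pw Xw.
apply: eA; have [_ fw] := pq w Xw.
rewrite (_ : f w - f x = (f w - p.[w] / q.[w]) + (p.[w] / q.[w] - p.[x] / q.[x]) -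
  (f x - p.[x] / q.[x])); last by ring.
apply: le_lt_trans (magB _ _) _.
by have := magD (f w - p.[w] / q.[w]) (p.[w] / q.[w] - p.[x] / q.[x]); lra.
Qed.

Lemma RX_rat_approx X f : RX X f -> rat_approx X f.
Proof.
case=> _ H e /H [r [p [q pq]] fr]; exists p, q => z Xz.
have [qz rz] := pq z Xz; split=> //.
by rewrite -ltcR -normE -rz; exact: fr.
Qed.

(** Compactness for increasing open covers. It serves to bound rational functions on compact sets
    and to pass from infinitely many holes to finitely many. *)
Lemma compact_exhaustion (K : set R[i]) (U : nat -> set R[i]) : compact K ->
  (forall n, open (U n)) -> (forall m n, (m <= n)%N -> U m `<=` U n) ->
  (forall z, K z -> exists n, U n z) -> exists n, K `<=` U n.
Proof.
rewrite compact_cover => cK oU mU KU.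
have [|D _ KD] := @cK nat setT U (fun n _ => oU n).
  by move=> z /KU [n Unz]; exists n.
exists (\max_(i <- finmap.enum_fset D) i)%N => z /KD [n nD]; apply: mU.
exact: leq_bigmax_seq.
Qed.

(** The cross-multiplied inequality contains q(z) != 0, so |p / q| < c becomes an open condition on
    the whole plane. *)
Lemma open_ratio_lt p q (c : R) : 0 <= c -> open [set z | mag p.[z] < c * mag q.[z]].
Proof.
move=> c0; rewrite openE => z /= pq; apply/nbhs_magP.
set s := c * mag q.[z] - mag p.[z].
have s2 : 0 < s / 2 by rewrite divr_gt0 // subr_gt0.
have sc : 0 < s / 2 / (c + 1) by rewrite divr_gt0 // ltr_wpDl.
have [d1 d10 H1] := horner_eps_delta p z s2.
have [d2 d20 H2] := horner_eps_delta q z sc.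
exists (Num.min d1 d2); first by rewrite lt_min d10.
move=> w; rewrite lt_min => /andP [/H1 h1 /H2]; rewrite ltr_pdivlMr ?ltr_wpDl //.
have := mag_sub_le p.[w] p.[z]; have := mag_sub_le q.[z] q.[w].
rewrite (mag_distC q.[z]) /= => h2 h3 h4; rewrite /s in h1 h4.
have := mag_ge0 (q.[w] - q.[z]).
move: (mag (q.[w] - q.[z])) h2 h4 => x h2 h4 x0; nra.
Qed.

Lemma rat_approx_bounded X f : compact X -> rat_approx X f ->
  exists2 M : R, 0 <= M & forall z, X z -> mag (f z) <= M.
Proof.
move=> cX /(_ 1 ltr01) [p [q pq]].
have [||z Xz|n Xn] := @compact_exhaustion X
  (fun n => [set z | mag p.[z] < n%:R * mag q.[z]]) cX.
- by move=> n; exact: open_ratio_lt.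
- move=> m n mn z /= h; apply: lt_le_trans h _.
  by rewrite ler_wpM2r ?mag_ge0 // ler_nat.
- have [qz _] := pq z Xz; exists (Num.bound (mag p.[z] / mag q.[z])) => /=.
  rewrite -ltr_pdivrMr ?mag_gt0 //; apply: archi_boundP.
  by rewrite divr_ge0 ?mag_ge0.
exists (n%:R + 1) => [|z Xz]; first by rewrite addr_ge0.
have [qz fz] := pq z Xz; have /= := Xn z Xz.
rewrite -ltr_pdivrMr ?mag_gt0 // -mag_div => h.
by have := mag_sub_le (f z) (p.[z] / q.[z]); lra.
Qed.

Lemma rat_approx_ext X f g : (forall z, X z -> f z = g z) -> rat_approx X g ->
  rat_approx X f.
Proof. by move=> fg H e /H [p [q pq]]; exists p, q => z Xz; rewrite fg //; exact: pq. Qed.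

Lemma rat_approx_lim X f : (forall e : R, 0 < e ->
  exists2 g, rat_approx X g & forall z, X z -> mag (f z - g z) <= e) -> rat_approx X f.
Proof.
move=> H e e0; have e2 : 0 < e / 2 by rewrite divr_gt0.
have [g Hg fg] := H _ e2; have [p [q pq]] := Hg _ e2.
exists p, q => z Xz; have [qz gz] := pq z Xz; split=> //.
by have := mag_triang (g z) (f z) (p.[z] / q.[z]); have := fg z Xz; lra.
Qed.

Lemma rat_approx_rat X p q : (forall z, X z -> q.[z] != 0) ->
  rat_approx X (fun z => p.[z] / q.[z]).
Proof. by move=> H e e0; exists p, q => z /H ?; rewrite subrr mag0. Qed.

Lemma rat_approx_poly X p : rat_approx X (fun z => p.[z]).
Proof.
apply: (@rat_approx_ext _ _ (fun z => p.[z] / (1 : {poly R[i]}).[z])).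
  by move=> z _; rewrite hornerC divr1.
by apply: rat_approx_rat => z _; rewrite hornerC oner_neq0.
Qed.

Lemma rat_approx_cst X c : rat_approx X (fun=> c).
Proof.
by apply: (@rat_approx_ext _ _ (fun z => c%:P.[z])) (rat_approx_poly _ _) => z _;
  rewrite hornerC.
Qed.

Lemma rat_approx_add X f g : rat_approx X f -> rat_approx X g ->
  rat_approx X (fun z => f z + g z).
Proof.
move=> Hf Hg e e0; have e2 : 0 < e / 2 by rewrite divr_gt0.
have [p1 [q1 H1]] := Hf _ e2; have [p2 [q2 H2]] := Hg _ e2.
exists (p1 * q2 + p2 * q1), (q1 * q2) => z Xz.
have [q10 f1] := H1 z Xz; have [q20 g1] := H2 z Xz.
rewrite !(hornerD, hornerM) mulf_neq0 //; split=> //.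
rewrite (_ : _ - _ = (f z - p1.[z] / q1.[z]) + (g z - p2.[z] / q2.[z])); last first.
  by field; rewrite ?q10 ?q20.
by have := magD (f z - p1.[z] / q1.[z]) (g z - p2.[z] / q2.[z]); lra.
Qed.

Lemma rat_approx_mul X f g : compact X -> rat_approx X f -> rat_approx X g ->
  rat_approx X (fun z => f z * g z).
Proof.
move=> cX Hf Hg e e0.
have [A A0 fA] := rat_approx_bounded cX Hf; have [B B0 gB] := rat_approx_bounded cX Hg.
(* With errors u of f and v of g below [d], the product has error at most A |v| + B |u| + |u| |v|,
   which is below e; |v| < 1 takes care of the last term. *)
pose d := Num.min 1 (e / (A + B + 2)).
have AB : 0 < A + B + 2 by lra.
have d0 : 0 < d by rewrite lt_min ltr01 divr_gt0.
have [p1 [q1 H1]] := Hf _ d0; have [p2 [q2 H2]] := Hg _ d0.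
exists (p1 * p2), (q1 * q2) => z Xz.
have [q10 f1] := H1 z Xz; have [q20 g1] := H2 z Xz.
rewrite !hornerM mulf_neq0 //; split=> //.
have := fA z Xz; have := gB z Xz.
move: f1 g1; set u := f z - _; set v := g z - _ => f1 g1 gz fz.
rewrite (_ : _ - _ = f z * v + u * g z - u * v); last first.
  by rewrite /u /v; field; rewrite ?q10 ?q20.
apply: le_lt_trans (magB _ _) _.
have := magD (f z * v) (u * g z); rewrite !magM => h.
move: f1 g1; rewrite !lt_min => /andP [u1 ue] /andP [v1 ve].
rewrite !ltr_pdivlMr // in ue ve.
have [mu0 mv0] := (mag_ge0 u, mag_ge0 v).
have h1 : mag (f z) * mag v <= A * mag v by rewrite ler_wpM2r.
have h2 : mag u * mag (g z) <= B * mag u by rewrite mulrC ler_wpM2r.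
have h3 : mag u * mag v <= mag u by rewrite ler_piMr // ltW.
move: (mag u) (mag v) mu0 mv0 ue ve h1 h2 h3 h => x y x0 y0 ue ve h1 h2 h3 h.
have h4 : A * y * (A + B + 2) <= A * e by rewrite -mulrA ler_wpM2l // ltW.
have h5 : B * x * (A + B + 2) <= B * e by rewrite -mulrA ler_wpM2l // ltW.
rewrite -(ltr_pM2r AB); apply: (@le_lt_trans _ _ (A * e + B * e + e)); last by lra.
apply: (@le_trans _ _ (A * y * (A + B + 2) + B * x * (A + B + 2) + x * (A + B + 2))).
  by rewrite -!mulrDl ler_pM2r //; lra.
by lra.
Qed.

Lemma rat_approx_sum X (I : Type) (s : seq I) (F : I -> R[i] -> R[i]) :
  (forall i, rat_approx X (F i)) -> rat_approx X (fun z => \sum_(i <- s) F i z).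
Proof.
move=> H; elim: s => [|i s IH].
  by apply: (rat_approx_ext _ (rat_approx_cst _ 0)) => z _; rewrite big_nil.
apply: (rat_approx_ext _ (rat_approx_add (H i) IH)) => z _; exact: big_cons.
Qed.

End RationalApproximation.

(** * McKissick's lemma *)

Section McKissick.
Variable R : realType.
Implicit Types (z w : R[i]) (X : set R[i]).

(** The intervals of radius 2 C / 2^n around u n are nested; the limit is the supremum of their left
    endpoints. *)
Lemma real_fast_cauchy (u : nat -> R) (C : R) :
  (forall n, `|u n.+1 - u n| <= C / 2 ^+ n) ->
  exists l, forall n, `|u n - l| <= 2 * C / 2 ^+ n.
Proof.
move=> H; pose a n := u n - 2 * C / 2 ^+ n; pose b n := u n + 2 * C / 2 ^+ n.
have half n : C / 2 ^+ n = 2 * C / 2 ^+ n.+1.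
  by rewrite exprS; field; rewrite expf_neq0 ?pnatr_eq0.
have am n : a n <= a n.+1.
  move: (H n); rewrite ler_norml /a -half => /andP [h _].
  by have := half n; rewrite -mulrA; lra.
have bm n : b n.+1 <= b n.
  move: (H n); rewrite ler_norml /b -half => /andP [_ h].
  by have := half n; rewrite -mulrA; lra.
have amono m n : (m <= n)%N -> a m <= a n.
  by move/subnK <-; elim: (n - m)%N => //= k IH; apply: le_trans IH (am _).
have bmono m n : (m <= n)%N -> b n <= b m.
  by move/subnK <-; elim: (n - m)%N => //= k IH; apply: le_trans (bm _) IH.
have C0 : 0 <= C by have := le_trans (normr_ge0 _) (H 0); rewrite expr0 divr1.
have ab m n : a m <= b n.
  have abk k : a k <= b k.
    have : 0 <= 2 * C / 2 ^+ k by apply: divr_ge0; [lra|exact: exprn_ge0].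
    by rewrite /a /b; lra.
  apply: le_trans (amono _ _ (leq_maxl m n)) _.
  by apply: le_trans (abk _) (bmono _ _ (leq_maxr m n)).
have hs : has_sup (range a).
  by split; [exists (a 0), 0|exists (b 0) => _ [k _ <-]; exact: ab].
exists (sup (range a)) => n.
have h1 : a n <= sup (range a) by apply: ub_le_sup; [exact: hs.2|exists n].
have h2 : sup (range a) <= b n.
  by apply: ge_sup; [exact: hs.1|move=> _ [k _ <-]; exact: ab].
by rewrite ler_norml; apply/andP; rewrite /a /b in h1 h2; split; lra.
Qed.

Lemma complex_fast_cauchy (u : nat -> R[i]) (C : R) :
  (forall n, mag (u n.+1 - u n) <= C / 2 ^+ n) ->
  exists l, forall n, mag (u n - l) <= 4 * C / 2 ^+ n.
Proof.
move=> H.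
have [|a Ha] := @real_fast_cauchy (fun n => Re (u n)) C.
  by move=> n; rewrite -ReB; apply: le_trans (Re_le_mag _) (H n).
have [|b Hb] := @real_fast_cauchy (fun n => Im (u n)) C.
  by move=> n; rewrite -ImB; apply: le_trans (Im_le_mag _) (H n).
exists (a +i* b) => n; apply: le_trans (mag_le_ReIm _) _; rewrite ReB ImB /=.
by have := Ha n; have := Hb n; lra.
Qed.

Lemma unity_roots n : (0 < n)%N -> exists2 s : seq R[i],
  size s = n & forall x, (x \in s) = (x ^+ n == 1).
Proof.
move=> n0; have [s sE] := closed_field_poly_normal ('X^n - 1 : {poly R[i]}).
have l1 : lead_coef ('X^n - 1 : {poly R[i]}) = 1.
  by apply/eqP; rewrite -monicE monicXnsubC.
rewrite l1 scale1r in sE; exists s.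
  have := size_prod_XsubC s id; rewrite /= -sE size_XnsubC //; by case.
by move=> x; rewrite -root_prod_XsubC -sE rootE !hornerE subr_eq0.
Qed.

(** For large n an approximate indicator function of the disc |z - a| < r; its poles are the points
    a + r x with x^n = 1. *)
Definition gfac (a : R[i]) (r : R) n z : R[i] := (1 - ((z - a) / r%:C) ^+ n)^-1.

Definition gfac_poly (a : R[i]) (r : R) n : {poly R[i]} :=
  1 - (('X - a%:P) * (r%:C)^-1%:P) ^+ n.

Lemma gfac_polyE a r n z : gfac a r n z = ((gfac_poly a r n).[z])^-1.
Proof. by rewrite /gfac /gfac_poly !hornerE. Qed.

Definition off_holes (H : nat -> seq (R[i] * R)) z :=
  forall n h, h \in H n -> h.2 <= mag (z - h.1).

(** * Körner's infinite product *)

Section Construction.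
Variables (c : R[i]) (rho e : R).
Hypotheses (rho0 : 0 < rho) (e0 : 0 < e) (e1 : e <= 1).

(** Radii in units of [rho]: sg 0 < rh 0 < sg 1 < rh 1 < ... < 1. The k-th factor has its poles on
    the circle of radius [rh k]; it is close to 1 within [sg k] and close to 0 beyond [sg k.+1]. *)
Let sg n : R := 1 - ((2 * n + 2)%:R)^-1.
Let rh n : R := 1 - ((2 * n + 3)%:R)^-1.
(** In the same units [d k] bounds the total radius of the holes of the k-th factor; these numbers
    add up to at most e. Off the holes the factor is bounded by 2 / d k, hence the bound [P n] for
    the product of the first n factors. *)
Let d n : R := e / 2 ^+ n.+1.
Let P n : R := \prod_(k < n) (2 / d k).
(** Tolerance of the n-th factor: small enough to beat the bound [P n] of the previous factors and
    the size of the next one. *)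
Let kap n : R := (2 ^+ (n + 4))^-1 / (P n * (1 + 2 / d n.+1)).

Let sg_half n : 1 / 2 <= sg n.
Proof.
have : ((2 * n + 2)%:R)^-1 <= 2^-1 :> R by rewrite lef_pV2 ?posrE ?ltr0n ?ler_nat; lia.
by rewrite /sg; lra.
Qed.

Let sg_rh n : sg n < rh n.
Proof.
rewrite /sg /rh ltrD2l ltrN2 ltf_pV2 ?posrE ?ltr0n ?ltr_nat; lia.
Qed.

Let rh_sg n : rh n < sg n.+1.
Proof.
rewrite /sg /rh ltrD2l ltrN2 ltf_pV2 ?posrE ?ltr0n ?ltr_nat; lia.
Qed.

Let sg_lt1 n : sg n < 1.
Proof. by rewrite /sg ltrBlDr ltrDl invr_gt0 ltr0n; lia. Qed.

Let d_gt0 n : 0 < d n. Proof. by rewrite divr_gt0 // exprn_gt0. Qed.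

Let d_le1 n : d n <= 1.
Proof.
rewrite ler_pdivrMr ?exprn_gt0 // mul1r; apply: le_trans e1 _.
by apply: exprn_ege1; lra.
Qed.

Let P_ge1 n : 1 <= P n.
Proof.
rewrite /P; elim: n => [|n IH]; first by rewrite big_ord0.
rewrite big_ord_recr /=; apply: mulr_ege1 => //.
by rewrite ler_pdivlMr ?d_gt0 // mul1r; have := d_le1 n; lra.
Qed.

Let kap_gt0 n : 0 < kap n.
Proof.
have := P_ge1 n; have := d_gt0 n.+1 => h1 h2.
have : 0 < 2 / d n.+1 by rewrite divr_gt0.
move=> h3; rewrite divr_gt0 ?invr_gt0 ?exprn_gt0 // mulr_gt0 //; lra.
Qed.

Let P_kap n : P n * (2 * kap n) * (1 + 2 / d n.+1) = (2 ^+ (n + 3))^-1.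
Proof.
have h1 := P_ge1 n; have h2 : 0 < 2 / d n.+1 by rewrite divr_gt0 ?d_gt0.
rewrite /kap addnS exprS; move: (2 / d n.+1) (P n) h1 h2 => x p h1 h2; field.
by rewrite expf_neq0 ?pnatr_eq0 //= !gt_eqF //; lra.
Qed.

Let P_kap_le n : P n * (2 * kap n) <= (2 ^+ (n + 3))^-1.
Proof.
have h2 : 0 < 2 / d n.+1 by rewrite divr_gt0 ?d_gt0.
rewrite -P_kap ler_peMr //; last by lra.
by apply: mulr_ge0; [have := P_ge1 n|have := kap_gt0 n]; lra.
Qed.

Let kap_le_half n : kap n <= 1 / 2.
Proof.
have h := P_kap_le n; have h1 := P_ge1 n; have h2 := kap_gt0 n.
have h3 : (2 ^+ (n + 3))^-1 <= 1 :> R.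
  by rewrite invf_le1 ?exprn_gt0 // exprn_ege1 //; lra.
by nra.
Qed.

(** Both ratios are below 1, so high powers are small; [gfac_bound] asks for powers of two. *)
Let exponents : exists m : nat -> nat, forall k,
  (sg k / rh k) ^+ (2 ^ m k) <= kap k /\ (rh k / sg k.+1) ^+ (2 ^ m k) <= kap k.
Proof.
suff H k : exists m, (sg k / rh k) ^+ (2 ^ m) <= kap k /\
    (rh k / sg k.+1) ^+ (2 ^ m) <= kap k.
  by have [m Hm] := choice H; exists m.
have [s0 s1] := (sg_half k, sg_half k.+1); have [h1 h2] := (sg_rh k, rh_sg k).
have [|N1 H1] := @expr_small R (sg k / rh k) (kap k) _ (kap_gt0 k).
  apply/andP; split; [apply: divr_ge0; lra|rewrite ltr_pdivrMr ?mul1r; lra].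
have [|N2 H2] := @expr_small R (rh k / sg k.+1) (kap k) _ (kap_gt0 k).
  by apply/andP; split; [apply: divr_ge0|rewrite ltr_pdivrMr ?mul1r]; lra.
exists (maxn N1 N2); split; [apply: H1|apply: H2].
  by apply: leq_trans (ltnW (ltn_expl _ _)); rewrite ?leq_maxl.
by apply: leq_trans (ltnW (ltn_expl _ _)); rewrite ?leq_maxr.
Qed.

(** The partial products [F n] converge uniformly off the holes. The limit is 0 for |z - c| >= rho,
    where every factor is tiny, and close to 1 for |z - c| <= rho / 2, where every factor is close
    to 1. *)
Lemma mckissick_scaled : exists H : nat -> seq (R[i] * R),
  [/\ forall n h, h \in H n -> mag (h.1 - c) <= rho /\ 0 < h.2,
      forall n, \sum_(k < n) \sum_(h <- H k) h.2 <= rho * e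
    & exists f, [/\ forall X, X `<=` off_holes H -> rat_approx X f,
        forall z, off_holes H z -> rho <= mag (z - c) -> f z = 0
      & forall z, off_holes H z -> mag (z - c) <= rho / 2 -> f z != 0]].
Proof.
have [m Hm] := exponents.
have rt k : {s : seq R[i] | size s = (2 ^ m k)%N &
    forall x, (x \in s) = (x ^+ (2 ^ m k) == 1)}.
  by apply: cid2; apply: unity_roots; rewrite expn_gt0.
pose N k := (2 ^ m k)%N.
have N0 k : 0 < (N k)%:R :> R by rewrite ltr0n expn_gt0.
have rh0 k : 0 < rh k by have := sg_half k; have := sg_rh k; lra.
have rh1 k : rh k < 1 by have := sg_lt1 k.+1; have := rh_sg k; lra.
have rr0 k : 0 < rho * rh k by rewrite mulr_gt0.
have rr_neq0 k : (rho * rh k)%:C != 0.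
  by rewrite -mag_gt0 magC normr_gt0 gt_eqF.
(* The radius is [d k / N k] in units of the pole circle, the separation that [gfac_bound] needs;
   the [N k] holes together have radius rho rh_k d_k. *)
pose hole k (x : R[i]) : R[i] * R := (c + (rho * rh k)%:C * x, rho * rh k * d k / (N k)%:R).
pose H k := [seq hole k x | x <- s2val (rt k)].
have Hroot k x : x ^+ N k = 1 -> hole k x \in H k.
  by move=> xN; apply: map_f; rewrite (s2valP' (rt k)); apply/eqP.
pose g k z := gfac c (rho * rh k) (N k) z.
pose q k := gfac_poly c (rho * rh k) (N k).
pose F n z := \prod_(k < n) g k z.
have mw k z : mag ((z - c) / (rho * rh k)%:C) = mag (z - c) / (rho * rh k).
  by rewrite mag_div magC gtr0_norm.
have cancel k s : s / rh k * (rho * rh k) = rho * s by field; rewrite gt_eqF.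
have g_far k z : off_holes H z -> (q k).[z] != 0 /\ mag (g k z) <= 2 / d k.
  move=> oz; have := @gfac_bound R (m k) (d k) ((z - c) / (rho * rh k)%:C).
  rewrite d_gt0 d_le1 => /(_ isT) [].
    move=> x xN; have := oz k _ (Hroot k x xN); rewrite /=.
    rewrite (_ : z - _ = ((z - c) / (rho * rh k)%:C - x) * (rho * rh k)%:C).
      by rewrite magM magC gtr0_norm // -mulrA mulrC ler_pM2r.
    by rewrite opprD addrA mulrBl divfK // mulrC.
  by move=> h1 h2; rewrite /q /gfac_poly !hornerE.
have g_near1 k z : mag (z - c) <= rho * sg k -> mag (g k z - 1) <= 2 * kap k.
  move=> hz; have hk : mag ((z - c) / (rho * rh k)%:C) ^+ N k <= kap k.
    apply: le_trans (Hm k).1; apply: lerXn2r; rewrite ?nnegrE ?mag_ge0 ?divr_ge0 //.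
    - by have := sg_half k; lra.
    - exact: ltW.
    by rewrite mw ler_pdivrMr // cancel.
  have [_ h] := gfac_near1 (le_trans hk (kap_le_half k)).
  by apply: le_trans h _; lra.
have g_near0 k z : rho * sg k.+1 <= mag (z - c) -> mag (g k z) <= 2 * kap k.
  move=> hz; have s0 := sg_half k.+1.
  have hk : (kap k)^-1 <= mag ((z - c) / (rho * rh k)%:C) ^+ N k.
    apply: (@le_trans _ _ ((sg k.+1 / rh k) ^+ N k)).
      rewrite -[sg _ / _]invf_div exprVn lef_pV2 ?posrE ?kap_gt0 ?exprn_gt0 ?divr_gt0 //.
        exact: (Hm k).2.
      by lra.
    apply: lerXn2r; rewrite ?nnegrE ?mag_ge0 ?divr_ge0 //; [lra|exact: ltW|].
    by rewrite mw ler_pdivlMr // mulrCA divfK ?gt_eqF.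
  have kh := kap_le_half k; have k0 := kap_gt0 k.
  have k2 : 2 <= (kap k)^-1 by rewrite -[2]invrK lef_pV2 ?posrE //; lra.
  have [_ h] := gfac_near0 (le_trans k2 hk); apply: le_trans h _.
  rewrite ler_pM2l // -[X in _ <= X]invrK lef_pV2 ?posrE ?invr_gt0 //.
  by apply: lt_le_trans hk; rewrite invr_gt0.
have F_bound n z : off_holes H z -> mag (F n z) <= P n.
  move=> oz; rewrite /F mag_prod; apply: ler_prod => k _.
  by rewrite mag_ge0 (g_far k z oz).2.
have F_step0 n z : off_holes H z -> mag (z - c) <= rho * sg n ->
    mag (F n.+1 z - F n z) <= (2 ^+ (n + 3))^-1.
  move=> oz hz; rewrite /F big_ord_recr /= -/(F n z) -[X in _ - X]mulr1 -mulrBr magM.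
  apply: le_trans (P_kap_le n); apply: ler_pM; rewrite ?mag_ge0 //; first exact: F_bound.
  exact: g_near1.
have F_zero n z : off_holes H z -> rho * sg n.+1 <= mag (z - c) ->
    mag (F n.+1 z) <= P n * (2 * kap n).
  move=> oz hz; rewrite /F big_ord_recr /= -/(F n z) magM.
  by apply: ler_pM; rewrite ?mag_ge0 //; [exact: F_bound|exact: g_near0].
(* Either z lies within [sg n.+1] and the new factor is close to 1, or factor n has already made the
   product so small that a new factor of size 2 / d n.+1 does no harm. *)
have F_step n z : off_holes H z -> mag (F n.+2 z - F n.+1 z) <= (2 ^+ (n + 3))^-1.
  move=> oz; case: (lerP (mag (z - c)) (rho * sg n.+1)) => hz.
    apply: le_trans (F_step0 _ _ oz hz) _.
    by rewrite lef_pV2 ?posrE ?exprn_gt0 // ler_weXn2l ?ler1n.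
  rewrite /F big_ord_recr /= -/(F n.+1 z) -[X in _ - X]mulr1 -mulrBr magM -P_kap.
  apply: ler_pM; rewrite ?mag_ge0 //; first exact: F_zero (ltW hz).
  have := (g_far n.+1 z oz).2; have := magB (g n.+1 z) 1; rewrite mag1; lra.
(* Points in the holes get an arbitrary value. The sequence starts at [F 1], from where [F_step]
   controls every increment. *)
have lim z : exists l, off_holes H z -> forall n, mag (F n.+1 z - l) <= (2 ^+ n.+1)^-1.
  case: (pselect (off_holes H z)) => oz; last by exists 0.
  have [|l Hl] := @complex_fast_cauchy (fun n => F n.+1 z) (1 / 8).
    by move=> n; apply: le_trans (F_step _ _ oz) _; rewrite exprD invfM; lra.
  by exists l => _ n; apply: le_trans (Hl n) _; rewrite exprS invfM; lra.
have [f Hf] := choice lim.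
exists H; split.
- move=> n h /mapP [x]; rewrite (s2valP' (rt n)) => /eqP xN -> /=.
  have Np : (0 < 2 ^ m n)%N by rewrite expn_gt0.
  have mx : mag x = 1.
    by apply/eqP; rewrite -(pexpr_eq1 Np (mag_ge0 _)) -magX xN mag1.
  split; last by rewrite divr_gt0 // mulr_gt0.
  rewrite addrC addKr magM magC mx mulr1 gtr0_norm // ler_piMr ?ltW //.
- move=> n; have dsum : \sum_(k < n) d k <= e.
    have -> : \sum_(k < n) d k = e - e / 2 ^+ n.
      elim: n => [|n IH]; first by rewrite big_ord0 expr0 divr1 subrr.
      by rewrite big_ord_recr /= IH /d exprS; field; rewrite expf_neq0 ?pnatr_eq0.
    by rewrite gerBl divr_ge0 ?exprn_ge0 ?ltW.
  apply: (@le_trans _ _ (rho * \sum_(k < n) d k)); last by rewrite ler_pM2l.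
  rewrite mulr_sumr; apply: ler_sum => k _; rewrite big_map /= big_const_seq count_predT.
  rewrite (s2valP (rt k)) iter_addr_0 /= -/(N k) -[_ *+ N k]mulr_natr divfK ?gt_eqF //.
  rewrite -mulrA.
  by rewrite ler_pM2l // ler_piMl ?ltW.
exists f; split.
- move=> X Xo; apply: rat_approx_lim => eps eps0.
  have [n0 Hn] := @expr_small R (1 / 2) eps ltac:(lra) eps0.
  exists (F n0.+1) => [|z /Xo oz].
    apply: (@rat_approx_ext _ _ _ (fun z => (1 : {poly R[i]}).[z] / (\prod_(k < n0.+1) q k).[z])).
      move=> z _; rewrite hornerC div1r horner_prod -prodfV.
      by apply: eq_bigr => k _; rewrite /g gfac_polyE.
    apply: rat_approx_rat => z /Xo oz; rewrite horner_prod prodf_seq_neq0.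
    by apply/allP => k _ /=; rewrite (g_far k z oz).1.
  rewrite mag_distC; apply: le_trans (Hf z oz n0) _; apply: le_trans (Hn n0.+1 _) => //.
  by rewrite div1r exprVn.
- move=> z oz hz; apply/eqP; rewrite -mag_eq0 eq_le mag_ge0 andbT.
  apply/ler_addgt0Pr => eps eps0; rewrite add0r.
  have [n Hn] := @expr_small R (1 / 2) (eps / 2) ltac:(lra) ltac:(lra).
  have h1 : mag (F n.+1 z) <= (2 ^+ (n + 3))^-1.
    apply: le_trans (P_kap_le n); apply: F_zero => //; apply: le_trans hz.
    by rewrite ler_piMr ?ltW.
  have := mag_sub_le (f z) (F n.+1 z); rewrite mag_distC.
  have := Hf z oz n.
  have : (2 ^+ (n + 3))^-1 <= (2 ^+ n.+1)^-1 / 2 :> R.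
    by rewrite -invfM -exprSr lef_pV2 ?posrE ?exprn_gt0 // ler_weXn2l ?ler1n //; lia.
  have : (1 / 2) ^+ n.+1 = (2 ^+ n.+1)^-1 :> R by rewrite div1r exprVn.
  have : 0 <= (2 ^+ n.+1)^-1 :> R by rewrite invr_ge0 exprn_ge0.
  by have := Hn n.+1 (leqnSn n); lra.
- move=> z oz hz; apply/eqP => fz.
  (* As F 0 = 1, the bounds |F 1 - F 0| <= 1/8 and |F 1 - f| <= 1/2 leave |f| >= 3/8. *)
  have h0 : mag (F 1%N z - F 0%N z) <= (2 ^+ 3)^-1.
    apply: F_step0 => //; apply: le_trans hz _; rewrite ler_pM2l //.
    by have := sg_half 0; lra.
  have := Hf z oz 0%N; rewrite fz subr0.
  have F0 : F 0%N z = 1 by rewrite /F big_ord0.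
  rewrite F0 in h0.
  have := mag_sub_le 1 (F 1%N z); rewrite mag1 mag_distC.
  have e2 : (2 ^+ 1)^-1 = 1 / 2 :> R by rewrite expr1 div1r.
  have e8 : (2 ^+ 3)^-1 = 1 / 8 :> R by rewrite div1r -natrX.
  by rewrite e2; rewrite e8 in h0; lra.
Qed.

End Construction.

(** The total radius scales with [rho], so the relative budget is eps / rho, capped at 1 for the
    construction. *)
Theorem mckissick (c : R[i]) (rho eps : R) : 0 < rho -> 0 < eps ->
  exists H : nat -> seq (R[i] * R),
  [/\ forall n h, h \in H n -> mag (h.1 - c) <= rho /\ 0 < h.2,
      forall n, \sum_(k < n) \sum_(h <- H k) h.2 <= eps
    & exists f, [/\ forall X, X `<=` off_holes H -> rat_approx X f,
        forall z, off_holes H z -> rho <= mag (z - c) -> f z = 0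
      & forall z, off_holes H z -> mag (z - c) <= rho / 2 -> f z != 0]].
Proof.
move=> rho0 eps0; pose e := Num.min 1 (eps / rho).
have e0 : 0 < e by rewrite lt_min ltr01 divr_gt0.
have e1 : e <= 1 by rewrite ge_min lexx.
have [H [h1 h2 h3]] := mckissick_scaled c rho0 e0 e1.
exists H; split=> // n; apply: le_trans (h2 n) _.
by rewrite mulrC -ler_pdivlMr // ge_min lexx orbT.
Qed.
End McKissick.

(** * Cauchy's formula with averages over roots of unity *)

Section DiscreteCauchy.
Variable R : realType.
Implicit Types (z w b : R[i]) (p q : {poly R[i]}) (f g : R[i] -> R[i]).

Definition tends (u : nat -> R[i]) (l : R[i]) := forall e : R, 0 < e ->
  exists N, forall n, (N <= n)%N -> mag (u n - l) <= e.

Lemma tends_ext u v l : (exists N, forall n, (N <= n)%N -> u n = v n) ->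
  tends v l -> tends u l.
Proof.
move=> [N uv] H e /H [M HM]; exists (maxn N M) => n; rewrite geq_max => /andP [Nn Mn].
by rewrite uv //; exact: HM.
Qed.

Lemma tends_add u v l k : tends u l -> tends v k -> tends (fun n => u n + v n) (l + k).
Proof.
move=> Hu Hv e e0; have e2 : 0 < e / 2 by rewrite divr_gt0.
have [N HN] := Hu _ e2; have [M HM] := Hv _ e2.
exists (maxn N M) => n; rewrite geq_max => /andP [/HN h1 /HM h2].
rewrite opprD addrACA; apply: le_trans (magD _ _) _; lra.
Qed.

Lemma tends_cst l : tends (fun=> l) l.
Proof. by move=> e e0; exists 0 => n _; rewrite subrr mag0 ltW. Qed.

Lemma tends_scale c u l : tends u l -> tends (fun n => c * u n) (c * l).
Proof.
move=> Hu e e0; have c0 := mag_ge0 c.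
have [N HN] := Hu (e / (mag c + 1)) ltac:(by rewrite divr_gt0 // ltr_wpDl).
exists N => n /HN; rewrite -mulrBr magM ler_pdivlMr ?ltr_wpDl //.
by have := mag_ge0 (u n - l); nra.
Qed.

Lemma tends_sum (I : eqType) (s : seq I) (u : I -> nat -> R[i]) (l : I -> R[i]) :
  (forall i, i \in s -> tends (u i) (l i)) ->
  tends (fun n => \sum_(i <- s) u i n) (\sum_(i <- s) l i).
Proof.
elim: s => [|i s IH] H.
  by rewrite big_nil; apply: tends_ext (tends_cst _); exists 0 => n _; rewrite big_nil.
rewrite big_cons; apply: tends_ext (tends_add (H i (mem_head _ _)) (IH _)).
  by exists 0 => n _; rewrite big_cons.
by move=> k ks; apply: H; rewrite inE ks orbT.
Qed.

Lemma prim_root_ex n : (0 < n)%N -> exists w : R[i], n.-primitive_root w.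
Proof.
move=> n0; have [s sE] := closed_field_poly_normal ('X^n - 1 : {poly R[i]}).
have l1 : lead_coef ('X^n - 1 : {poly R[i]}) = 1.
  by apply/eqP; rewrite -monicE monicXnsubC.
rewrite l1 scale1r in sE.
have : has n.-primitive_root s.
  apply: has_prim_root => //.
  - apply/allP => x; rewrite -root_prod_XsubC -sE rootE !hornerE subr_eq0.
    by rewrite unity_rootE.
  - by rewrite -separable_prod_XsubC -sE separable_Xn_sub_1 // pnatr_eq0 -lt0n.
  - by have := size_prod_XsubC s id; rewrite /= -sE size_XnsubC // => -[->].
by case/hasP => w _ Hw; exists w.
Qed.

(** The default 1 is taken for n = 0 only. *)
Definition omega n : R[i] := xget 1 [set w | n.-primitive_root w].

Lemma omega_prim n : (0 < n)%N -> n.-primitive_root (omega n).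
Proof. move=> n0; have [w Hw] := prim_root_ex n0.
exact: (@xgetPex _ 1 [set w | n.-primitive_root w] (ex_intro _ w Hw)). Qed.

Lemma omega_mag n j : (0 < n)%N -> mag (omega n ^+ j) = 1.
Proof.
move=> n0; rewrite magX; have := prim_expr_order (omega_prim n0).
move=> h; have : mag (omega n) = 1.
  by apply/eqP; rewrite -(pexpr_eq1 n0 (mag_ge0 _)) -magX h mag1.
by move=> ->; rewrite expr1n.
Qed.

Lemma omega_sum n k : (0 < k < n)%N -> \sum_(j < n) (omega n ^+ k) ^+ j = 0.
Proof.
case/andP=> k0 kn; have n0 := leq_ltn_trans (leq0n _) kn.
have pr := omega_prim n0.
have k1 : omega n ^+ k - 1 != 0.
  by rewrite subr_eq0 -(prim_order_dvd pr) gtnNdvd.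
apply: (mulfI k1); rewrite -subrX1 mulr0 -exprM mulnC exprM (prim_expr_order pr).
by rewrite expr1n subrr.
Qed.

Definition cpt n (a : R[i]) (r : R) j := a + r%:C * omega n ^+ j.

(** The Riemann sum with n equidistant nodes of the Cauchy integral of f over the circle |w - a| =
    r: there dw / (2 pi i) is (w - a) times the normalised arc length. *)
Definition cauchy_avg n (a : R[i]) (r : R) f z : R[i] := n%:R^-1 *
  \sum_(j < n) f (cpt n a r j) * (cpt n a r j - a) / (cpt n a r j - z).

Lemma cpt_mag n a r j : (0 < n)%N -> 0 < r -> mag (cpt n a r j - a) = r.
Proof.
by move=> n0 r0; rewrite /cpt addrC addKr magM magC omega_mag // mulr1 gtr0_norm.
Qed.

Lemma cpt_neq n a r j z : (0 < n)%N -> 0 < r -> mag (z - a) != r -> cpt n a r j - z != 0.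
Proof.
move=> n0 r0; apply: contra => /eqP h; have := cpt_mag a j n0 r0.
by rewrite (_ : cpt n a r j = z) => [->//|]; apply/eqP; rewrite -subr_eq0 h.
Qed.

(** Each term is (1 - u^n)^-1 times a finite geometric sum in u; averaging over the roots of unity
    kills every power but the zeroth. *)
Lemma cauchy_avg1 n a r z : (0 < n)%N -> 0 < r -> mag (z - a) != r ->
  cauchy_avg n a r (fun=> 1) z = (1 - ((z - a) / r%:C) ^+ n)^-1.
Proof.
move=> n0 r0 zr; set u := (z - a) / r%:C; set W := omega n.
have rC : r%:C != 0 by rewrite -mag_gt0 magC gtr0_norm.
have W0 j : W ^+ j != 0 by rewrite -mag_gt0 omega_mag.
have Wn : W ^+ n = 1 by apply: prim_expr_order; exact: omega_prim.
have nz : (n%:R : R[i]) != 0 by rewrite pnatr_eq0 -lt0n.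
have zE : z = a + r%:C * u by rewrite /u; field.
have un : 1 - u ^+ n != 0.
  apply: contra zr; rewrite subr_eq0 => /eqP h.
  have := mag_div (z - a) r%:C; rewrite -/u magC gtr0_norm // => mu.
  have mu1 : mag u = 1.
    by apply/eqP; rewrite -(pexpr_eq1 n0 (mag_ge0 _)) -magX -h mag1.
  by rewrite -[mag (z - a)](divfK (lt0r_neq0 r0)) -mu mu1 mul1r.
clearbody u; have term (j : 'I_n) : 1 * (cpt n a r j - a) / (cpt n a r j - z) =
    (1 - u ^+ n)^-1 * \sum_(k < n) u ^+ k * (W ^+ (n - k)) ^+ j.
  have cz := cpt_neq j n0 r0 zr.
  have Wu : W ^+ j - u != 0.
    by move: cz; rewrite /cpt zE (_ : _ - _ = r%:C * (W ^+ j - u)) ?mulf_eq0 ?negb_or;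
      [case/andP|ring].
  rewrite /cpt -/W zE.
  rewrite (_ : 1 * _ / _ = (1 - u / W ^+ j)^-1); last first.
    field. rewrite W0 Wu /=; move: cz; rewrite /cpt zE; exact.
  apply: (mulfI un); rewrite [RHS]mulrA divff // mul1r.
  have -> : 1 - u ^+ n = 1 - (u / W ^+ j) ^+ n.
    by rewrite expr_div_n -exprM mulnC exprM Wn expr1n divr1.
  rewrite -opprB subrX1 -mulNr opprB mulrAC divff ?mul1r.
    apply: eq_bigr => k _; rewrite expr_div_n; congr (_ * _).
    rewrite -exprM -exprM; apply: (mulfI (W0 (j * k)%N)).
    rewrite divff // -exprD (_ : (j * k + (n - k) * j = n * j)%N).
      by rewrite exprM Wn expr1n.
    by rewrite mulnBl [(k * j)%N]mulnC subnKC // mulnC leq_mul2r ltnW ?orbT.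
  by rewrite -(divff (W0 j)) -mulrBl mulf_neq0 ?invr_eq0.
rewrite /cauchy_avg (eq_bigr _ (fun j _ => term j)) -mulr_sumr exchange_big /=.
rewrite (bigD1 (Ordinal n0)) //= [X in _ * (_ + X)]big1 => [|k k0].
  rewrite addr0 subn0 Wn expr0 (eq_bigr (fun=> 1)) => [|j _]; last by rewrite mul1r expr1n.
  by rewrite sumr_const card_ord mulrCA mulVf // mulr1.
rewrite -mulr_sumr omega_sum ?mulr0 // subn_gt0 ltn_ord /=.
by rewrite ltn_subrL n0 lt0n -(inj_eq val_inj) /= in k0 *; rewrite k0.
Qed.

(** Write p = s (X - z) + p(z). The quotient s contributes the sum of s(w) (w - a) over the nodes;
    expanded in the root of unity, its exponents lie strictly between 0 and n, so it vanishes once n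
    is large. *)
Lemma cauchy_avg_poly a r p : exists M, forall n z, (M <= n)%N -> 0 < r ->
  mag (z - a) != r ->
  cauchy_avg n a r (fun w => p.[w]) z = p.[z] * cauchy_avg n a r (fun=> 1) z.
Proof.
exists (size p).+2 => n z pn r0 zr; have n0 : (0 < n)%N by apply: leq_trans pn.
have [s sE] : exists s, p = s * ('X - z%:P) + p.[z]%:P.
  have /factor_theorem [s Hs] : root (p - p.[z]%:P) z.
    by rewrite rootE !hornerE subrr.
  by exists s; rewrite -Hs subrK.
have szs : (size s < size p)%N \/ s = 0.
  have [->|s0] := eqVneq s 0; [by right|left].
  have ss : size (s * ('X - z%:P)) = (size s).+1.
    by rewrite size_Mmonic ?monicXsubC // size_XsubC addn2.
  suff <- : size (s * ('X - z%:P) + p.[z]%:P) = (size s).+1 by rewrite {2}sE.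
  rewrite size_polyDl ss //; apply: leq_ltn_trans (size_polyC_leq1 _) _.
  by rewrite ltnS lt0n size_poly_eq0.
pose l : {poly R[i]} := r%:C *: 'X + a%:P; pose t := s \Po l.
have szt : (size t < n)%N.
  have szl : (size l <= 2)%N.
    rewrite /l (leq_trans (size_polyD _ _)) // geq_max.
    rewrite (leq_trans (size_scale_leq _ _)) ?size_polyX //.
    exact: leq_trans (size_polyC_leq1 _) _.
  have h : (size t <= ((size s).-1 * (size l).-1).+1)%N.
    exact: size_comp_poly_leq.
  have h1 : ((size s).-1 * (size l).-1 <= (size s).-1 * 1)%N.
    by rewrite leq_mul2l; apply/orP; right; lia.
  by case: szs => [hs|s0]; [|move: h h1; rewrite s0 size_poly0 mul0n]; lia.
have s_zero : \sum_(j < n) s.[cpt n a r j] * (cpt n a r j - a) = 0.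
  rewrite (eq_bigr (fun j : 'I_n => \sum_(k < size t) r%:C * t`_k * (omega n ^+ k.+1) ^+ j)).
    rewrite exchange_big big1 //= => k _; rewrite -mulr_sumr omega_sum ?mulr0 //.
    by rewrite ltnS /=; apply: leq_ltn_trans szt; exact: ltn_ord.
  move=> j _.
  have -> : s.[cpt n a r j] = t.[omega n ^+ j].
    by rewrite /t horner_comp /l !hornerE addrC.
  rewrite horner_coef mulr_suml; apply: eq_bigr => k _.
  by rewrite /cpt addrC addKr -!exprM mulSn exprD mulnC; ring.
rewrite /cauchy_avg mulrCA; congr (_ * _); rewrite mulr_sumr.
apply: etrans (_ : _ = \sum_(j < n) p.[z] * (1 * (cpt n a r j - a) / (cpt n a r j - z)) +
    \sum_(j < n) s.[cpt n a r j] * (cpt n a r j - a)) _; last by rewrite s_zero addr0.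
rewrite -big_split /=.
have pw w : p.[w] = s.[w] * (w - z) + p.[z] by rewrite {1}sE !hornerE.
apply: eq_bigr => j _; rewrite pw.
by field; exact: cpt_neq.
Qed.

Lemma cauchy_avg1_tends a r z : 0 < r -> mag (z - a) != r ->
  tends (fun n => cauchy_avg n a r (fun=> 1) z) (mag (z - a) < r)%R%:R.
Proof.
move=> r0 zr; set u := (z - a) / r%:C.
apply: (@tends_ext _ (fun n => (1 - u ^+ n)^-1)).
  by exists 1%N => n n0; exact: cauchy_avg1.
have mu : mag u = mag (z - a) / r by rewrite mag_div magC gtr0_norm.
move: zr; rewrite neq_lt => /orP [zr|zr] e e0.
- rewrite zr; pose e' := Num.min (1 / 2) (e / 2).
  have e'0 : 0 < e' by rewrite lt_min; apply/andP; split; lra.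
  have u1 : 0 <= mag u < 1 by rewrite mag_ge0 mu ltr_pdivrMr // mul1r.
  have [N HN] := expr_small u1 e'0.
  exists N => n /HN; rewrite le_min => /andP [h1 h2].
  by have [_ h] := gfac_near1 h1; apply: le_trans h _; lra.
- rewrite ltNge (ltW zr) /=; have u0 : 0 < mag u by rewrite mu divr_gt0 // (lt_trans r0).
  pose e' := Num.min (1 / 2) (e / 2).
  have e'0 : 0 < e' by rewrite lt_min; apply/andP; split; lra.
  have u1 : 0 <= (mag u)^-1 < 1.
    by rewrite invr_ge0 mag_ge0 invf_lt1 // mu ltr_pdivlMr // mul1r.
  have [N HN] := expr_small u1 e'0.
  exists N => n /HN; rewrite le_min exprVn => /andP [h1 h2].
  have h3 : 2 <= mag u ^+ n.
    by move: h1; rewrite -[_^-1]div1r ler_pdivrMr ?exprn_gt0 //; lra.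
  by have [_ h] := gfac_near0 h3; rewrite subr0; apply: le_trans h _; lra.
Qed.

Lemma cauchy_avg_le n a r f z (M d : R) : (0 < n)%N -> 0 < r -> 0 < d ->
  (forall w, mag (w - a) = r -> mag (f w / (w - z)) <= M / d) ->
  mag (cauchy_avg n a r f z) <= M * r / d.
Proof.
move=> n0 r0 d0 H; rewrite /cauchy_avg magM magV mag_nat mulrC ler_pdivrMr ?ltr0n //.
apply: le_trans (mag_sum _ _ _) _.
have -> : M * r / d * n%:R = \sum_(j < n) (M * r / d).
  by rewrite sumr_const card_ord mulr_natr.
apply: ler_sum => j _; have cm := cpt_mag a j n0 r0.
rewrite mulrAC magM cm mulrAC ler_pM2r //; exact: H.
Qed.

(* A cycle is a list of [(s, a, r)]: the circle with centre [a] and radius [r],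
   taken with multiplicity [s]. *)
Implicit Type C : seq (R[i] * R[i] * R).

Definition off_cycle C z := forall c, c \in C -> mag (z - c.1.2) != c.2.

Definition winding C z : R[i] := \sum_(c <- C) c.1.1 * (mag (z - c.1.2) < c.2)%R%:R.

Definition cycle_avg C n f z : R[i] :=
  \sum_(c <- C) c.1.1 * cauchy_avg n c.1.2 c.2 f z.

Definition pos_radii C := forall c, c \in C -> 0 < c.2.

Lemma off_cycle_gap C b : off_cycle C b ->
  exists2 d : R, 0 < d & forall c, c \in C -> d <= `|mag (b - c.1.2) - c.2|.
Proof.
elim: C => [|c C IH] H; first by exists 1.
have [|d d0 Hd] := IH; first by move=> x xC; apply: H; rewrite inE xC orbT.
exists (Num.min d `|mag (b - c.1.2) - c.2|).
  by rewrite lt_min d0 normr_gt0 subr_eq0 H ?inE ?eqxx.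
by move=> x; rewrite inE => /orP [/eqP ->|/Hd h]; rewrite ge_min ?lexx ?h ?orbT.
Qed.

(** The poles are listed with multiplicity, so that Cauchy's formula can be proved by induction on
    the list. *)
Definition root_quot p (bs : seq R[i]) w : R[i] := p.[w] / \prod_(b <- bs) (w - b).

Lemma root_quot_cons p b bs w : root_quot p (b :: bs) w = root_quot p bs w / (w - b).
Proof. by rewrite /root_quot big_cons invfM [_^-1 * _]mulrC mulrA. Qed.

Lemma root_quot_bounded p bs C : {in bs, forall b, off_cycle C b} -> pos_radii C ->
  exists2 M : R, 0 <= M &
    forall c w, c \in C -> mag (w - c.1.2) = c.2 -> mag (root_quot p bs w) <= M.
Proof.
move=> + Cpos; elim: bs => [|b bs IH] H.
  have [B B0 HB] : exists2 B : R, 0 <= B & forall c, c \in C -> mag c.1.2 + c.2 <= B.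
    elim: C Cpos {H} => [|c C IH] Cpos; first by exists 0.
    have [|B B0 HB] := IH; first by move=> x xC; apply: Cpos; rewrite inE xC orbT.
    exists (Num.max B (mag c.1.2 + c.2)); first by rewrite le_max B0.
    by move=> x; rewrite inE => /orP [/eqP ->|/HB h]; rewrite le_max ?lexx ?h ?orbT.
  have [L L0 HL] := horner_lipschitz p B0; exists L => // c w cC wc.
  rewrite /root_quot big_nil divr1; have := HB _ cC.
  have h := mag_sub_le w c.1.2 => h2.
  have wB : mag w <= B by lra.
  by have [] := HL w w wB wB.
have [|M M0 HM] := IH; first by move=> x xb; apply: H; rewrite inE xb orbT.
have [|d d0 Hd] := @off_cycle_gap C b; first by apply: H; rewrite inE eqxx.
exists (M / d); first by rewrite divr_ge0 // ltW.
move=> c w cC wc; rewrite root_quot_cons mag_div.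
have wb : d <= mag (w - b).
  apply: le_trans (Hd _ cC) _; rewrite -wc distrC; apply: le_trans (mag_dist_le _ _) _.
  by rewrite (_ : _ - _ = w - b) //; ring.
have M1 := HM _ _ cC wc.
by rewrite ler_pM ?mag_ge0 ?invr_ge0 ?mag_ge0 // lef_pV2 ?posrE //; lra.
Qed.

Lemma cycle_avg_poly C p z : pos_radii C -> off_cycle C z ->
  tends (fun n => cycle_avg C n (fun w => p.[w]) z) (winding C z * p.[z]).
Proof.
rewrite /cycle_avg /winding; elim: C => [|c C IH] Cpos Cz.
  by rewrite big_nil mul0r; apply: tends_ext (tends_cst _); exists 0 => n _; rewrite big_nil.
rewrite big_cons mulrDl -mulrA.
apply: tends_ext (_ : tends (fun n => c.1.1 * cauchy_avg n c.1.2 c.2 (fun w => p.[w]) z +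
   \sum_(c <- C) c.1.1 * cauchy_avg n c.1.2 c.2 (fun w => p.[w]) z) _).
  by exists 0 => n _; rewrite big_cons.
apply: tends_add; last first.
  by apply: IH => x xC; [apply: Cpos|apply: Cz]; rewrite inE xC orbT.
apply: tends_scale; rewrite mulrC.
have c0 : 0 < c.2 by apply: Cpos; rewrite inE eqxx.
have cz : mag (z - c.1.2) != c.2 by apply: Cz; rewrite inE eqxx.
have [M HM] := cauchy_avg_poly c.1.2 c.2 p.
apply: tends_ext (tends_scale p.[z] (cauchy_avg1_tends c0 cz)).
by exists M => n Mn; exact: HM.
Qed.

(** Partial fractions at each node: 1 / ((w - b) (w - z)) is (1 / (w - z) - 1 / (w - b)) / (z -
    b). *)
Lemma cycle_avg_div C n f z b : (0 < n)%N -> pos_radii C -> off_cycle C z ->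
  off_cycle C b -> z != b ->
  cycle_avg C n (fun w => f w / (w - b)) z = (z - b)^-1 * (cycle_avg C n f z - cycle_avg C n f b).
Proof.
move=> n0 Cpos Cz Cb zb; rewrite /cycle_avg -sumrB mulr_sumr.
apply: eq_big_seq => c cC; rewrite -mulrBr [RHS]mulrCA; congr (_ * _).
rewrite /cauchy_avg -mulrBr [RHS]mulrCA; congr (_ * _); rewrite -sumrB mulr_sumr.
apply: eq_bigr => j _.
have h1 := cpt_neq j n0 (Cpos _ cC) (Cz _ cC); have h2 := cpt_neq j n0 (Cpos _ cC) (Cb _ cC).
by field; rewrite h1 h2 subr_eq0 zb.
Qed.

(** At z = b the identity [cycle_avg_div] divides by 0. A nearby point replaces b: same winding
    number, and averages that are close uniformly in n. *)
Lemma cycle_avg_equicont C f b (M : R) : pos_radii C -> off_cycle C b -> 0 <= M ->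
  (forall c w, c \in C -> mag (w - c.1.2) = c.2 -> mag (f w) <= M) ->
  forall e : R, 0 < e -> exists2 z, z != b & [/\ off_cycle C z, winding C z = winding C b &
    forall n, (0 < n)%N -> mag (cycle_avg C n f z - cycle_avg C n f b) <= e].
Proof.
move=> Cpos Cb M0 HM e e0; have [d d0 Hd] := off_cycle_gap Cb.
pose S := \sum_(c <- C) mag c.1.1 * (M * c.2 * 2 / d ^+ 2).
have S0 : 0 <= S.
  rewrite /S big_seq; apply: sumr_ge0 => c cC; apply: mulr_ge0; first exact: mag_ge0.
  have c0 := ltW (Cpos _ cC); apply: divr_ge0; last by rewrite exprn_ge0 ?ltW.
  by rewrite !mulr_ge0.
(* A shift by at most d / 2 keeps the point on the same side of every circle, and t S <= e controls
   the averages. *)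
pose t := Num.min (d / 2) (e / (S + 1)).
have t0 : 0 < t by rewrite lt_min !divr_gt0 // ltr_wpDl.
have td : t <= d / 2 by rewrite ge_min lexx.
pose z := b + t%:C.
have zbt : mag (z - b) = t by rewrite /z addrC addKr magC gtr0_norm.
have far c w : c \in C -> mag (w - c.1.2) = c.2 -> d <= mag (w - b) /\ d / 2 <= mag (w - z).
  move=> cC wc; have h : d <= mag (w - b).
    apply: le_trans (Hd _ cC) _; rewrite -wc distrC; apply: le_trans (mag_dist_le _ _) _.
    by rewrite (_ : _ - _ = w - b) //; ring.
  by split=> //; have := mag_triang z w b; rewrite zbt; lra.
have side c : c \in C -> mag (z - c.1.2) != c.2 /\
    (mag (z - c.1.2) < c.2) = (mag (b - c.1.2) < c.2).
  move=> cC; have := Hd _ cC; have h : `|mag (z - c.1.2) - mag (b - c.1.2)| <= t.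
    apply: le_trans (mag_dist_le _ _) _; rewrite -zbt.
    by rewrite (_ : _ - _ = z - b) //; ring.
  move: h; rewrite ler_norml => /andP [h1 h2]; rewrite ler_normr => /orP [] h3.
    by split; [apply/eqP; lra|rewrite !ltNge; congr (~~ _); apply/idP/idP => _; lra].
  by split; [apply/eqP; lra|apply/idP/idP => _; lra].
exists z; first by rewrite -subr_eq0 -mag_gt0 zbt.
split.
- by move=> c /side [].
- by apply: eq_big_seq => c /side [_ ->].
move=> n n0; rewrite /cycle_avg -sumrB; apply: le_trans (mag_sum _ _ _) _.
apply: (@le_trans _ _ (t * S)); last first.
  have : t <= e / (S + 1) by rewrite ge_min lexx orbT.
  by rewrite ler_pdivlMr ?ltr_wpDl //; nra.
rewrite /S mulr_sumr big_seq [X in _ <= X]big_seq; apply: ler_sum => c cC.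
have c0 := Cpos _ cC.
rewrite -mulrBr magM mulrCA ler_wpM2l ?mag_ge0 //.
have -> : cauchy_avg n c.1.2 c.2 f z - cauchy_avg n c.1.2 c.2 f b =
    cauchy_avg n c.1.2 c.2 (fun w => f w * (z - b) / (w - b)) z.
  have Cz := (side _ cC).1.
  rewrite /cauchy_avg -mulrBr -sumrB; congr (_ * _); apply: eq_bigr => j _.
  have h1 := cpt_neq j n0 c0 Cz; have h2 := cpt_neq j n0 c0 (Cb _ cC).
  by field; rewrite h1 h2.
have -> : t * (M * c.2 * 2 / d ^+ 2) = (t * M * 2 / d) * c.2 / d.
  by field; rewrite gt_eqF.
apply: cauchy_avg_le => // w wc; have [h1 h2] := far _ _ cC wc.
rewrite !mag_div magM zbt.
have -> : t * M * 2 / d / d = M * t / d / (d / 2) by field; rewrite gt_eqF.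
have ip (x y : R) : 0 < x -> x <= y -> y^-1 <= x^-1.
  by move=> x0 xy; rewrite lef_pV2 ?posrE //; lra.
have d20 : 0 < d / 2 by rewrite divr_gt0.
have n1 : 0 <= mag (f w) * t by rewrite mulr_ge0 ?mag_ge0 ?ltW.
apply: ler_pM; [by rewrite divr_ge0 ?mag_ge0|by rewrite invr_ge0 mag_ge0| |exact: ip].
apply: ler_pM => //; [by rewrite invr_ge0 mag_ge0| |exact: ip].
by rewrite ler_pM2r //; exact: HM wc.
Qed.

(** Induction on the poles. For z different from the new pole b, [cycle_avg_div] applies and the
    average at b tends to 0, the winding number there being 0. For z = b the limit is 0, by
    comparison with a nearby point. *)
Lemma cycle_avg_root_quot C p bs z : pos_radii C ->
  {in bs, forall b, off_cycle C b /\ winding C b = 0} -> off_cycle C z ->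
  tends (fun n => cycle_avg C n (root_quot p bs) z) (winding C z * root_quot p bs z).
Proof.
move=> Cpos; elim: bs z => [|b bs IH] z Hbs Cz.
  have E : root_quot p [::] = (fun w => p.[w]).
    by apply/funext => w; rewrite /root_quot big_nil divr1.
  by rewrite E; exact: cycle_avg_poly.
have {}IH y : off_cycle C y ->
    tends (fun n => cycle_avg C n (root_quot p bs) y) (winding C y * root_quot p bs y).
  by apply: IH => x xb; apply: Hbs; rewrite inE xb orbT.
have [Cb wb] : off_cycle C b /\ winding C b = 0 by apply: Hbs; rewrite inE eqxx.
have E : root_quot p (b :: bs) = (fun w => root_quot p bs w / (w - b)).
  by apply/funext => w; rewrite root_quot_cons.
have main y : off_cycle C y -> y != b ->
    tends (fun n => cycle_avg C n (root_quot p (b :: bs)) y)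
      (winding C y * root_quot p (b :: bs) y).
  move=> Cy yb; rewrite E; have := tends_add (IH y Cy) (tends_scale (-1) (IH b Cb)).
  rewrite wb mul0r mulr0 addr0 => /(tends_scale (y - b)^-1) H.
  rewrite mulrA [X in tends _ X]mulrC; apply: tends_ext H; exists 1%N => n n0.
  by rewrite mulN1r cycle_avg_div.
have [zb|zb] := eqVneq z b; last exact: main.
rewrite {}zb wb mul0r => e e0; have e2 : 0 < e / 2 by rewrite divr_gt0.
have [|M M0 HM] := @root_quot_bounded p (b :: bs) C _ Cpos.
  by move=> x /Hbs [].
have [y yb [Cy wy Hy]] := cycle_avg_equicont Cpos Cb M0 HM e2.
have := main y Cy yb; rewrite wy wb mul0r => /(_ _ e2) [N HN].
exists (maxn 1 N) => n; rewrite geq_max => /andP [n0 /HN]; rewrite subr0 => h.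
have := Hy n n0; rewrite subr0 mag_distC => h2.
by have := mag_sub_le (cycle_avg C n (root_quot p (b :: bs)) b)
     (cycle_avg C n (root_quot p (b :: bs)) y); lra.
Qed.

Theorem discrete_cauchy_formula C p q z : pos_radii C -> q != 0 ->
  (forall b, root q b -> off_cycle C b /\ winding C b = 0) -> off_cycle C z ->
  tends (fun n => cycle_avg C n (fun w => p.[w] / q.[w]) z) (winding C z * (p.[z] / q.[z])).
Proof.
move=> Cpos q0 Hq Cz; have [bs qE] := closed_field_poly_normal q.
have Eq : (fun w => p.[w] / q.[w]) = root_quot ((lead_coef q)^-1 *: p) bs.
  apply/funext => w; rewrite /root_quot {1}qE !hornerE horner_prod invfM.
  rewrite mulrCA mulrA; congr (_ / _); apply: eq_bigr => b _; rewrite hornerXsubC //.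
rewrite Eq (_ : p.[z] / q.[z] = root_quot ((lead_coef q)^-1 *: p) bs z); last first.
  by rewrite -Eq.
apply: cycle_avg_root_quot => // b bbs; apply: Hq.
by rewrite qE rootZ ?lead_coef_eq0 // root_prod_XsubC.
Qed.

End DiscreteCauchy.

(** * Merging overlapping discs *)

Section MergingDiscs.
Variables (R : realType) (D : nat -> R).
Hypotheses (D_gt0 : forall l, 0 < D l) (D_mono : forall l m, (l <= m)%N -> D m <= D l).

(* A disc [(a, r, l)] with centre [a], radius [r] and level [l]. *)
Implicit Type L : seq (R[i] * R * nat).

Definition in_disc (h : R[i] * R * nat) (z : R[i]) := mag (z - h.1.1) < h.1.2.

(** A merged disc is no longer centred at a hole centre, but its closure still contains one; that
    point keeps the disc off the real axis. *)
Definition anchored (h : R[i] * R * nat) :=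
  0 < h.1.2 /\ exists2 c : R[i], mag (c - h.1.1) <= h.1.2 & D h.2 <= `|Im c|.

(** Up to a constant, a bound for what the circles of level at least m contribute to Cauchy kernels
    at real points. *)
Definition level_weight L m : R := \sum_(h <- L | (m <= h.2)%N) h.1.2 / D h.2.

Definition total_radius L : R := \sum_(h <- L) h.1.2.

Lemma total_radius_cons h L : total_radius (h :: L) = h.1.2 + total_radius L.
Proof. exact: big_cons. Qed.

Lemma total_radius_perm h L L' : perm_eq L (h :: L') ->
  total_radius L = h.1.2 + total_radius L'.
Proof. by move=> pL; rewrite /total_radius (perm_big _ pL) big_cons. Qed.

(** Strict, so that the closed discs are disjoint and no boundary circle meets another disc. *)
Definition disjoint_discs (g h : R[i] * R * nat) := g.1.2 + h.1.2 < mag (g.1.1 - h.1.1).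

Lemma disjoint_discs_sym : symmetric disjoint_discs.
Proof. by move=> g h; rewrite /disjoint_discs addrC mag_distC. Qed.

Lemma not_pairwise_disjoint_discs L : ~~ pairwise disjoint_discs L ->
  exists g h L', perm_eq L (g :: h :: L') /\ ~~ disjoint_discs g h.
Proof.
elim: L => //= g L IH; rewrite negb_and => /orP [|/IH [x [y [L' [pL sxy]]]]].
  rewrite -has_predC => /hasP [h hL /= sgh]; exists g, h, (rem h L); split=> //.
  by rewrite perm_cons perm_to_rem.
exists x, y, (g :: L'); split=> //.
by rewrite perm_sym (perm_catCA [:: x; y] [:: g] L') /= perm_cons perm_sym.
Qed.

(** The centre divides the segment so that a disc of radius r + s covers both. The lower level is
    kept, with the anchor of its disc; it has the larger [D], so the weights do not grow. *)
Lemma merge_two g h : anchored g -> anchored h -> ~~ disjoint_discs g h ->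
  exists k, [/\ anchored k, k.1.2 = g.1.2 + h.1.2,
    forall z, in_disc g z \/ in_disc h z -> in_disc k z
  & forall m, (if (m <= k.2)%N then k.1.2 / D k.2 else 0) <=
      (if (m <= g.2)%N then g.1.2 / D g.2 else 0) +
      (if (m <= h.2)%N then h.1.2 / D h.2 else 0)].
Proof.
case: g h => [[a r] l] [[b s] m]; rewrite /anchored /disjoint_discs /in_disc /= -leNgt.
move=> [r0 [c ca Dc]] [s0 [d db Dd]] ab.
have rs : 0 < r + s by rewrite addr_gt0.
pose x := a + (b - a) * (s / (r + s))%:C.
have ax : mag (a - x) <= s.
  rewrite /x opprD addrA subrr add0r magN magM mag_distC magC ger0_norm; last first.
    by rewrite divr_ge0 ?ltW.
  by rewrite mulrA ler_pdivrMr // mulrC ler_pM2l.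
have bx : mag (b - x) <= r.
  have -> : b - x = (b - a) * (r / (r + s))%:C.
    have -> : r / (r + s) = 1 - s / (r + s) by field; rewrite gt_eqF.
    by rewrite rmorphB rmorph1 /x; ring.
  rewrite magM mag_distC magC ger0_norm; last by rewrite divr_ge0 ?ltW.
  by rewrite mulrA ler_pdivrMr // mulrC ler_pM2l.
exists (x, r + s, minn l m); split=> //=.
- split=> //; case: (leqP l m) => _.
    by exists c => //; have := mag_triang a c x; lra.
  by exists d => //; have := mag_triang b d x; lra.
- by move=> z [zr|zs]; [have := mag_triang a z x|have := mag_triang b z x]; lra.
- move=> n.
  have inv i j : (i <= j)%N -> (D i)^-1 <= (D j)^-1.
    by move=> ij; rewrite lef_pV2 ?posrE ?D_gt0 ?D_mono.
  have il : (D (minn l m))^-1 <= (D l)^-1 by rewrite inv ?geq_minl.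
  have im : (D (minn l m))^-1 <= (D m)^-1 by rewrite inv ?geq_minr.
  have p1 : 0 <= r / D l by rewrite divr_ge0 ?ltW.
  have p2 : 0 <= s / D m by rewrite divr_ge0 ?ltW.
  rewrite leq_min; case: leqP => _; case: leqP => _ /=; try lra.
  by rewrite mulrDl lerD // ler_pM2l.
Qed.

(** Each step removes a disc: one that reaches the outer circle is dropped and the outer circle
    shrunk past it, or two that are not disjoint are merged. *)
Lemma merge_discs L (rho : R) : (forall h, h \in L -> anchored h) ->
  exists L' (rho' : R), [/\ rho - 3 * total_radius L <= rho' <= rho,
    forall h, h \in L' -> anchored h /\ mag h.1.1 + h.1.2 < rho',
    pairwise disjoint_discs L',
    forall z, has (in_disc^~ z) L -> has (in_disc^~ z) L' \/ rho' < mag z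
  & forall m, level_weight L' m <= level_weight L m].
Proof.
have [n] := ubnP (size L); elim: n L rho => // n IH L rho; rewrite ltnS => Ln HL.
have term_ge0 h : anchored h -> 0 <= h.1.2 / D h.2.
  by case=> h0 _; rewrite divr_ge0 ?ltW.
case: (boolP (has (fun h => rho <= mag h.1.1 + h.1.2) L)) => [/hasP [h hL hrho]|inside].
  have pL := perm_to_rem hL; have [h0 _] := HL h hL.
  (* The points of the dropped disc have modulus above rho - 2 r, hence lie beyond the new outer
     circle. *)
  have [||L' [rho' [/andP [r1 r2] H1 H2 H3 H4]]] := IH (rem h L) (rho - 3 * h.1.2).
  - by move: Ln; rewrite size_rem //; case: (L) hL.
  - by move=> x /mem_rem; exact: HL.
  exists L', rho'; split=> //.
  - by rewrite (total_radius_perm pL); apply/andP; split; lra.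
  - move=> z; rewrite (perm_has _ pL) /= => /orP [zh|]; last exact: H3.
    right; rewrite /in_disc in zh; have := mag_sub_le h.1.1 z; rewrite mag_distC; lra.
  - move=> m; apply: le_trans (H4 m) _; rewrite /level_weight (perm_big _ pL) big_cons.
    by case: ifP => _; rewrite ?lexx // lerDr; exact: term_ge0 (HL _ hL).
case: (boolP (pairwise disjoint_discs L)) => [sep|].
  exists L, rho; split=> //.
  - rewrite lexx gerBl mulr_ge0 // /total_radius big_seq.
    by apply: sumr_ge0 => h /HL [h0 _]; exact: ltW.
  - move=> h hL; split; first exact: HL.
    by rewrite ltNge; apply: contra inside => ?; apply/hasP; exists h.
  - by move=> z; left.
case/not_pairwise_disjoint_discs => g [h [T [pL sgh]]].
have gL : g \in L by rewrite (perm_mem pL) inE eqxx.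
have hL : h \in L by rewrite (perm_mem pL) !inE eqxx orbT.
have [k [ak rk cov wk]] := merge_two (HL _ gL) (HL _ hL) sgh.
have [||L' [rho' [rr H1 H2 H3 H4]]] := IH (k :: T) rho.
- by move: Ln; rewrite (perm_size pL).
- move=> x; rewrite inE => /orP [/eqP -> //|xT]; apply: HL.
  by rewrite (perm_mem pL) !inE xT !orbT.
exists L', rho'; split=> //.
- by move: rr; rewrite (total_radius_perm pL) !total_radius_cons rk addrA.
- move=> z; rewrite (perm_has _ pL) /= => hz; apply: H3 => /=.
  by case/or3P: hz => hz; rewrite ?hz ?orbT // cov //; [left|right].
- move=> m; apply: le_trans (H4 m) _; rewrite /level_weight (perm_big _ pL) !big_cons.
  have := wk m; move: (\sum_(j <- T | _) _) => S; do 3! case: ifP => _ /=; lra.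
Qed.

End MergingDiscs.

(** * Extrapolation of Cauchy kernels *)

Section KernelExtrapolation.
Variable R : realType.

(** The pairs (coefficient, node) describe a finite combination of evaluations at real points,
    applied here to x |-> 1 / (w - x). *)
Definition kernel_comb (s : seq (R[i] * R)) (w : R[i]) : R[i] :=
  \sum_(k <- s) k.1 / (w - k.2%:C).

(** The error formula of Lagrange interpolation for x |-> 1 / (w - x), with coefficients independent
    of w. A new node x is added by subtracting from the error at t the multiple [c] of the error at
    x that makes it vanish at t = x. *)
Lemma lagrange_kernel (xs : seq R) (t : R) : uniq xs ->
  exists2 s : seq (R[i] * R), {subset [seq k.2 | k <- s] <= xs} &
  forall w, w != t%:C -> (forall x, x \in xs -> w != x%:C) ->
    (w - t%:C)^-1 - kernel_comb s w =
    (\prod_(x <- xs) (t - x)%:C) / ((\prod_(x <- xs) (w - x%:C)) * (w - t%:C)).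
Proof.
elim: xs t => [|x xs IH] t /=.
  by move=> _; exists [::] => // w wt _; rewrite /kernel_comb !big_nil subr0 !mul1r.
case/andP=> xxs uxs; have [s1 n1 E1] := IH t uxs; have [s2 n2 E2] := IH x uxs.
pose c := (\prod_(y <- xs) (t - y)%:C) / \prod_(y <- xs) (x - y)%:C.
exists (s1 ++ [seq (- c * k.1, k.2) | k <- s2] ++ [:: (c, x)]).
  move=> y; rewrite !map_cat !mem_cat -map_comp /= inE => /or3P [/n1 h|/n2 h|/eqP ->].
  - by rewrite inE h orbT.
  - by rewrite inE h orbT.
  - by rewrite inE eqxx.
move=> w wt wx; have wxs y : y \in xs -> w != y%:C by move=> h; apply: wx; rewrite inE h orbT.
have wx0 : w != x%:C by apply: wx; rewrite inE eqxx.
have {}E1 := E1 w wt wxs; have {}E2 := E2 w wx0 wxs.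
have nz : \prod_(y <- xs) (x - y)%:C != 0.
  rewrite prodf_seq_neq0; apply/allP => y yxs /=.
  by rewrite -mag_gt0 magC normr_gt0 subr_eq0; apply: contraNneq xxs => ->.
have nw : \prod_(y <- xs) (w - y%:C) != 0.
  by rewrite prodf_seq_neq0; apply/allP => y yxs /=; rewrite subr_eq0 wxs.
have -> : kernel_comb (s1 ++ [seq (- c * k.1, k.2) | k <- s2] ++ [:: (c, x)]) w =
    kernel_comb s1 w - c * kernel_comb s2 w + c / (w - x%:C).
  rewrite /kernel_comb !big_cat /= big_map big_seq1 /= addrA; congr (_ + _ + _).
  by rewrite mulr_sumr -sumrN; apply: eq_bigr => k _; rewrite mulNr mulNr mulrA.
have -> : (w - t%:C)^-1 - (kernel_comb s1 w - c * kernel_comb s2 w + c / (w - x%:C)) =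
   ((w - t%:C)^-1 - kernel_comb s1 w) - c * ((w - x%:C)^-1 - kernel_comb s2 w) by ring.
rewrite E1 E2 !big_cons rmorphB /= /c; field.
by rewrite nw nz !subr_eq0 wt wx0.
Qed.

Variable eta : R.
Hypothesis eta0 : 0 < eta.

Definition far (w : R[i]) := forall t : R, 0 <= t <= 1 -> eta <= mag (w - t%:C).

(** On functions spanned by kernels with poles at distance at least eta from [0,1], evaluation at t
    is a limit of combinations of evaluations on [0,1/2]. *)
Definition reachable (t : R) := forall e : R, 0 < e ->
  exists2 s : seq (R[i] * R), (forall k, k \in s -> 0 <= k.2 <= 1 / 2) &
    forall w, far w -> mag ((w - t%:C)^-1 - kernel_comb s w) <= e.

Lemma reachable_comb (s : seq (R[i] * R)) : (forall k, k \in s -> reachable k.2) ->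
  forall e : R, 0 < e ->
  exists2 s' : seq (R[i] * R), (forall k, k \in s' -> 0 <= k.2 <= 1 / 2) &
    forall w, far w -> mag (kernel_comb s w - kernel_comb s' w) <= e.
Proof.
elim: s => [|k s IH] Hs e e0.
  by exists [::] => // w _; rewrite subrr mag0 ltW.
have e2 : 0 < e / 2 by rewrite divr_gt0.
have [|s1 n1 H1] := IH _ _ e2; first by move=> x xs; apply: Hs; rewrite inE xs orbT.
have c0 : 0 < mag k.1 + 1 by rewrite ltr_wpDl // mag_ge0.
have [s2 n2 H2] := Hs k (mem_head _ _) _ (divr_gt0 e2 c0).
exists ([seq (k.1 * x.1, x.2) | x <- s2] ++ s1).
  move=> x; rewrite mem_cat => /orP [/mapP [y /n2 h ->] //|]; exact: n1.
move=> w fw; rewrite {1}/kernel_comb big_cons -/(kernel_comb s w).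
have -> : kernel_comb ([seq (k.1 * x.1, x.2) | x <- s2] ++ s1) w =
    k.1 * kernel_comb s2 w + kernel_comb s1 w.
  rewrite /kernel_comb big_cat big_map mulr_sumr; congr (_ + _).
  by apply: eq_bigr => x _; rewrite mulrA.
rewrite (_ : _ - _ = k.1 * ((w - k.2%:C)^-1 - kernel_comb s2 w) +
  (kernel_comb s w - kernel_comb s1 w)); last by ring.
apply: le_trans (magD _ _) _; rewrite magM.
have := H1 w fw; have := H2 w fw; rewrite ler_pdivlMr //.
have := mag_ge0 ((w - k.2%:C)^-1 - kernel_comb s2 w); have := mag_ge0 k.1.
by move: (mag k.1) (mag (_^-1 - _)) => x y x0 y0; nra.
Qed.

(** Interpolate at n nodes just to the left of s. Nodes are within eta / 4 of t and at least eta
    from w, so each contributes a factor at most 1/4 to the error; then each node is replaced by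
    combinations on [0,1/2]. *)
Lemma reachable_step (s t : R) : 1 / 2 <= s <= 1 -> t <= 1 -> s <= t <= s + eta / 8 ->
  (forall x, 0 <= x <= s -> reachable x) -> reachable t.
Proof.
move=> /andP [s12 s1] t1 /andP [st ts] Hs e e0; have e2 : 0 < e / 2 by rewrite divr_gt0.
(* The minimum with 1 keeps the nodes positive, since s >= 1/2. *)
pose d := Num.min 1 eta / 8.
have d0 : 0 < d by rewrite divr_gt0 // lt_min ltr01.
have d1 : d <= 1 / 8 by rewrite ler_pM2r ?invr_gt0 // ge_min lexx.
have de : d <= eta / 8 by rewrite ler_pM2r ?invr_gt0 // ge_min lexx orbT.
have e2eta : 0 < e / 2 * eta by rewrite mulr_gt0.
have [n Hn] := @expr_small R (1 / 4) (e / 2 * eta) ltac:(lra) e2eta.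
pose x k : R := s - d / k.+1%:R.
have xs k : s - d <= x k <= s.
  apply/andP; split; last by rewrite gerBl divr_ge0 // ltW.
  by rewrite lerD2l lerN2 ler_pdivrMr // ler_peMr ?ler1n // ltW.
have xinj : injective x.
  move=> j k /(addrI s) /oppr_inj /(mulfI (lt0r_neq0 d0)) /invr_inj /eqP.
  by rewrite eqr_nat => /eqP [].
pose nodes := [seq x k | k <- iota 0 n].
have [|c cn Hc] := @lagrange_kernel nodes t; first by rewrite map_inj_uniq ?iota_uniq.
have nodesP y : y \in nodes -> s - d <= y <= s by case/mapP=> k _ ->.
have [|c' c'n Hc'] := @reachable_comb c _ _ e2.
  move=> k kc; apply: Hs; have /nodesP : k.2 \in nodes by apply/cn/map_f.
  by case/andP=> h1 h2; apply/andP; split; lra.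
exists c' => // w fw.
have far_in y : 0 <= y <= 1 -> eta <= mag (w - y%:C) /\ w != y%:C.
  move=> /fw h; split=> //; apply: contraTneq h => ->.
  by rewrite subrr mag0 -ltNge.
have node01 y : y \in nodes -> 0 <= y <= 1.
  by move=> /nodesP /andP [h1 h2]; apply/andP; split; lra.
have t01 : 0 <= t <= 1 by apply/andP; split; lra.
have {}Hc := Hc w (far_in _ t01).2 (fun y yn => (far_in y (node01 y yn)).2).
suff h : mag ((w - t%:C)^-1 - kernel_comb c w) <= e / 2.
  by have := mag_triang (kernel_comb c w) (w - t%:C)^-1 (kernel_comb c' w);
     have := Hc' w fw; lra.
rewrite {}Hc mag_div magM.
have wt := (far_in _ t01).1.
suff h : mag (\prod_(x <- nodes) (t - x)%:C) <=
    (1 / 4) ^+ n * mag (\prod_(x <- nodes) (w - x%:C)).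
  have p0 : 0 < mag (\prod_(x <- nodes) (w - x%:C)).
    rewrite mag_gt0 prodf_seq_neq0; apply/allP => y yn /=.
    by rewrite subr_eq0 (far_in y (node01 y yn)).2.
  rewrite ler_pdivrMr; last by rewrite mulr_gt0 //; lra.
  apply: le_trans h _; rewrite [X in _ <= X]mulrCA [X in _ <= X]mulrC ler_pM2r //.
  by apply: le_trans (Hn n (leqnn n)) _; rewrite ler_pM2l.
have szn : size nodes = n by rewrite size_map size_iota.
rewrite !mag_prod -szn; elim: (nodes) nodesP node01 => [|y l IH] Hy H01.
  by rewrite !big_nil expr0 mul1r.
rewrite !big_cons /= exprS mulrACA; apply: ler_pM.
- exact: mag_ge0.
- by rewrite -mag_prod mag_ge0.
- rewrite magC; have /andP [h1 h2] := Hy y (mem_head _ _).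
  have [h3 _] := far_in y (H01 y (mem_head _ _)).
  by rewrite ler_norml; apply/andP; split; lra.
- by apply: IH => z zl; [apply: Hy|apply: H01]; rewrite inE zl orbT.
Qed.

(** Steps of length eta / 8 lead from 1/2 to 1. *)
Lemma kernel_extrapolation : reachable 1.
Proof.
suff H n : forall t, 0 <= t <= 1 -> t <= 1 / 2 + n%:R * (eta / 8) -> reachable t.
  apply: (H (Num.bound (1 / (eta / 8)))); first by rewrite ler01 lexx.
  have h0 : 0 < eta / 8 by rewrite divr_gt0.
  have : 1 / (eta / 8) <= (Num.bound (1 / (eta / 8)))%:R.
    by apply/ltW/archi_boundP; rewrite divr_ge0 // ltW.
  by rewrite ler_pdivrMr //; lra.
elim: n => [|n IH] t /andP [t0 t1] tn.
  move=> e e0; exists [:: (1, t)].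
    by move=> k; rewrite inE => /eqP -> /=; apply/andP; split; lra.
  by move=> w _; rewrite /kernel_comb big_seq1 /= div1r subrr mag0 ltW.
have ne : 0 <= n%:R * (eta / 8) by rewrite mulr_ge0 // divr_ge0 // ltW.
case: (lerP t (1 / 2 + n%:R * (eta / 8))) => tn'; first by apply: IH; rewrite ?t0.
apply: (@reachable_step (1 / 2 + n%:R * (eta / 8))) => //.
- by apply/andP; split; lra.
- by rewrite -(natr1 n) in tn; apply/andP; split; lra.
- by move=> x /andP [x0 x1]; apply: IH => //; apply/andP; split; lra.
Qed.

End KernelExtrapolation.

(** * Extrapolation on a finite Swiss cheese *)

Section SwissCheeseEstimate.
Variables (R : realType) (D : nat -> R).
Hypotheses (D_gt0 : forall l, 0 < D l) (D_mono : forall l m, (l <= m)%N -> D m <= D l)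
  (D_le1 : forall l, D l <= 1).
Implicit Type L : seq (R[i] * R * nat).

Lemma pairwise_disjoint_discs_mem L g h : pairwise (@disjoint_discs R) L -> g \in L -> h \in L ->
  g != h -> disjoint_discs g h.
Proof.
elim: L => //= x L IH /andP [/allP xL pL]; rewrite !inE.
case/orP=> [/eqP ->|gL]; case/orP=> [/eqP ->|hL] gh; rewrite ?eqxx // in gh *.
- exact: xL.
- by rewrite disjoint_discs_sym; exact: xL.
- exact: IH.
Qed.

Lemma pairwise_disjoint_discs_uniq L : (forall h, h \in L -> 0 < h.1.2) ->
  pairwise (@disjoint_discs R) L -> uniq L.
Proof.
elim: L => //= x L IH H0 /andP [/allP xL pL]; rewrite IH ?andbT // => [|h hL]; last first.
  by apply: H0; rewrite inE hL orbT.
apply/negP => /xL; rewrite /disjoint_discs subrr mag0.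
by have := H0 x (mem_head _ _); lra.
Qed.

Lemma level_weight_mem L h : (forall g, g \in L -> anchored D g) -> h \in L ->
  h.1.2 / D h.2 <= level_weight D L 0.
Proof.
move=> HL hL; rewrite /level_weight (perm_big _ (perm_to_rem hL)) big_cons /= lerDl.
rewrite big_seq_cond; apply: sumr_ge0 => g /andP [/mem_rem /HL [g0 _] _].
by rewrite divr_ge0 // ltW.
Qed.

(** A single radius is at most D / 8, so w is within D / 4 of the anchor. *)
Lemma anchored_Im L h w : (forall g, g \in L -> anchored D g) ->
  level_weight D L 0 <= 1 / 8 -> h \in L -> mag (w - h.1.1) <= h.1.2 ->
  D h.2 / 2 <= `|Im w|.
Proof.
move=> HL W0 hL wh; have [h0 [c ca Dc]] := HL h hL.
have := le_trans (level_weight_mem HL hL) W0; rewrite ler_pdivrMr // => rD.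
have := Im_le_mag (w - c); rewrite ImB => h1.
have h2 := mag_triang h.1.1 w c; rewrite (mag_distC h.1.1 c) in h2.
have h3 : `|Im c| <= `|Im w| + `|Im w - Im c|.
  by rewrite -{1}[Im c](subrK (Im w)) [_ + Im w]addrC [`|Im w - _|]distrC ler_normD.
have := D_gt0 h.2; lra.
Qed.

Lemma cauchy_avg_comb n a r (f : R[i] -> R[i]) z (s : seq (R[i] * R)) :
  cauchy_avg n a r f z - \sum_(k <- s) k.1 * cauchy_avg n a r f k.2%:C =
  n%:R^-1 * \sum_(j < n) f (cpt n a r j) * (cpt n a r j - a) *
    ((cpt n a r j - z)^-1 - kernel_comb s (cpt n a r j)).
Proof.
rewrite /cauchy_avg; under [X in _ - X]eq_bigr => k _ do rewrite mulrCA.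
rewrite -mulr_sumr -mulrBr; congr (_ * _).
under [X in _ - X]eq_bigr => k _ do rewrite mulr_sumr.
rewrite exchange_big -sumrB; apply: eq_bigr => j _ /=.
rewrite [RHS]mulrBr; congr (_ - _); rewrite /kernel_comb mulr_sumr; apply: eq_bigr => k _.
by rewrite mulrCA.
Qed.

Lemma cauchy_avg_comb_le n a r (f : R[i] -> R[i]) z (s : seq (R[i] * R)) (M t : R) :
  (0 < n)%N -> 0 < r -> 0 <= M ->
  (forall w, mag (w - a) = r -> mag (f w) <= M /\ mag ((w - z)^-1 - kernel_comb s w) <= t) ->
  mag (cauchy_avg n a r f z - \sum_(k <- s) k.1 * cauchy_avg n a r f k.2%:C) <= M * r * t.
Proof.
move=> n0 r0 M0 H; rewrite cauchy_avg_comb magM magV mag_nat mulrC ler_pdivrMr ?ltr0n //.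
apply: le_trans (mag_sum _ _ _) _.
have -> : M * r * t * n%:R = \sum_(j < n) (M * r * t).
  by rewrite sumr_const card_ord mulr_natr.
apply: ler_sum => j _; have cm := cpt_mag a j n0 r0; have [h1 h2] := H _ cm.
rewrite !magM cm; apply: ler_pM; rewrite ?mulr_ge0 ?mag_ge0 ?(ltW r0) //.
by rewrite ler_pM2r.
Qed.

Lemma kernel_comb_le (s : seq (R[i] * R)) w (d : R) : 0 < d ->
  (forall k, k \in s -> d <= mag (w - k.2%:C)) ->
  mag (kernel_comb s w) <= (\sum_(k <- s) mag k.1) / d.
Proof.
move=> d0 H; apply: le_trans (mag_sum _ _ _) _; rewrite mulr_suml big_seq [X in _ <= X]big_seq.
apply: ler_sum => k /H h; rewrite mag_div ler_wpM2l ?mag_ge0 // lef_pV2 ?posrE //.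
exact: lt_le_trans h.
Qed.

(** By Cauchy's formula the left side is an average of p / q against the extrapolation error of the
    kernel. On the outer circle and on circles of level at most m this error is at most tau; on the
    others it is bounded crudely and their weight [cw] makes up for it. *)
Theorem swiss_estimate L (p q : {poly R[i]}) (M tau cw : R) m (s : seq (R[i] * R)) :
  (forall h, h \in L -> anchored D h) ->
  level_weight D L 0 <= 1 / 8 -> level_weight D L m.+1 <= cw -> 0 <= M -> 0 <= tau ->
  (forall z : R[i], mag z <= 4 -> ~~ has ((@in_disc R)^~ z) L ->
    q.[z] != 0 /\ mag (p.[z] / q.[z]) <= M) ->
  (forall k, k \in s -> 0 <= k.2 <= 1 / 2) ->
  (forall w, far (D m / 4) w -> mag ((w - 1%:C)^-1 - kernel_comb s w) <= tau) ->
  mag (p.[1%:C] / q.[1%:C] - \sum_(k <- s) k.1 * (p.[k.2%:C] / q.[k.2%:C])) <=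
    M * (4 * tau + 2 * (1 + \sum_(k <- s) mag k.1) * cw).
Proof.
move=> HL W0 Wm M0 tau0 Hf s_nodes s_far; set Lam := \sum_(k <- s) mag k.1.
have Lam0 : 0 <= Lam by apply: sumr_ge0 => k _; exact: mag_ge0.
pose f w := p.[w] / q.[w].
(* The total radius is at most 1/8, so an outer circle started at radius 3 ends between 2 and 3:
   around [0,1] at distance at least 1, and inside |z| <= 4. *)
have [L' [rho [/andP [rho2 rho3] H1 H2 H3 H4]]] := merge_discs D_gt0 D_mono 3 HL.
have HL' h : h \in L' -> anchored D h by case/H1.
have W0' : level_weight D L' 0 <= 1 / 8 := le_trans (H4 0) W0.
have {}rho2 : 2 <= rho.
  have : total_radius L <= level_weight D L 0.
    rewrite /total_radius /level_weight big_seq [X in _ <= X]big_seq_cond.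
    rewrite [X in _ <= X](eq_bigl (fun h => h \in L)) => [|h]; last by rewrite leq0n andbT.
    apply: ler_sum => h /HL [h0 _]; rewrite ler_pdivlMr //.
    by rewrite ler_piMr // ltW.
  by lra.
have fM w : mag w <= rho -> (forall h, h \in L' -> h.1.2 <= mag (w - h.1.1)) ->
    mag (f w) <= M.
  move=> wr wh; suff nL : ~~ has ((@in_disc R)^~ w) L by apply: (Hf w _ nL).2; lra.
  apply/negP => /H3 []; last by lra.
  by case/hasP => h /wh; rewrite /in_disc; lra.
have on_disc h w : h \in L' -> mag (w - h.1.1) = h.1.2 ->
    mag w < rho /\ forall g, g \in L' -> g.1.2 <= mag (w - g.1.1).
  move=> hL wh; have [_ hr] := H1 _ hL.
  split; first by have := mag_sub_le w h.1.1; lra.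
  move=> g gL; have [->|gh] := eqVneq g h; first by rewrite wh.
  have := pairwise_disjoint_discs_mem H2 gL hL gh; rewrite /disjoint_discs.
  by have := mag_triang w g.1.1 h.1.1; rewrite (mag_distC g.1.1 w); lra.
(* Outer circle minus inner circles: the winding number is 1 on [0,1] and 0 at the poles. *)
pose C : seq (R[i] * R[i] * R) := (1, 0, rho) :: [seq (-1, h.1.1, h.1.2) | h <- L'].
have Cpos : pos_radii C.
  move=> c; rewrite inE => /orP [/eqP -> /=|/mapP [h /HL' [h0 _] ->] //]; lra.
have uL' : uniq L' := pairwise_disjoint_discs_uniq (fun h hL => (HL' h hL).1) H2.
have wind z : mag z < rho -> winding C z = 1 - (\sum_(h <- L') (in_disc h z)%:R).
  move=> zr; rewrite /winding big_cons /= subr0 zr mulr1 big_map -sumrN.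
  by congr (_ + _); apply: eq_bigr => h _; rewrite /= mulN1r.
have offC z : mag z != rho -> (forall h, h \in L' -> mag (z - h.1.1) != h.1.2) -> off_cycle C z.
  move=> zr zh c; rewrite inE => /orP [/eqP -> /=|/mapP [h hL ->]]; first by rewrite subr0.
  exact: zh.
have q0 : q != 0.
  have n1 : ~~ has ((@in_disc R)^~ 1%:C) L.
    apply/negP => /hasP [h hL /ltW /(anchored_Im HL W0 hL)].
    by rewrite /= normr0; have := D_gt0 h.2; lra.
  have [] := Hf 1%:C _ n1; first by rewrite magC normr1; lra.
  by move=> + _; apply: contra_neq => ->; rewrite horner0.
(* A pole lies in a hole or outside |z| <= 4, hence in exactly one merged disc or beyond the outer
   circle. *)
have roots b : root q b -> off_cycle C b /\ winding C b = 0.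
  move=> rb; have {rb} : has ((@in_disc R)^~ b) L' \/ rho < mag b.
    case: (boolP (has ((@in_disc R)^~ b) L)) => [/H3 //|nb]; right; rewrite ltNge; apply/negP => br.
    by have [] := Hf b ltac:(lra) nb; rewrite (rootP rb) eqxx.
  case=> [/hasP [g gL bg]|br].
  - have [g0 gr] := H1 _ gL; rewrite /in_disc in bg.
    have br : mag b < rho by have := mag_sub_le b g.1.1; lra.
    have out h : h \in L' -> h != g -> h.1.2 < mag (b - h.1.1).
      move=> hL hg; have := pairwise_disjoint_discs_mem H2 hL gL hg; rewrite /disjoint_discs.
      by have := mag_triang b h.1.1 g.1.1; rewrite (mag_distC h.1.1 b); lra.
    split.
      apply: offC; first by rewrite lt_eqF.
      move=> h hL; have [->|hg] := eqVneq h g; first by rewrite lt_eqF.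
      by rewrite gt_eqF // out.
    rewrite wind // (bigD1_seq g) //= {1}/in_disc bg big_seq_cond big1 => [|h /andP [hL hg]].
      by rewrite addr0 subrr.
    by rewrite /in_disc ltNge ltW // out.
  - have out h : h \in L' -> h.1.2 < mag (b - h.1.1).
      by case/H1 => _ hr; have := mag_sub_le b h.1.1; lra.
    split; first by apply: offC => [|h /out h1]; rewrite gt_eqF.
    rewrite /winding big_cons /= subr0 [_ < rho]ltNge (ltW br) mulr0 add0r big_map big_seq big1 //.
    by move=> h /out h1 /=; rewrite ltNge ltW ?mulr0.
have real_pt (x : R) : 0 <= x <= 1 -> off_cycle C x%:C /\ winding C x%:C = 1.
  case/andP=> x0 x1; have mx : mag x%:C < rho by rewrite magC ger0_norm //; lra.
  have out h : h \in L' -> h.1.2 < mag (x%:C - h.1.1).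
    move=> hL; rewrite ltNge; apply/negP => /(anchored_Im HL' W0' hL).
    by rewrite /= normr0; have := D_gt0 h.2; lra.
  split; first by apply: offC => [|h /out h1]; [rewrite lt_eqF|rewrite gt_eqF].
  rewrite wind // big_seq big1 ?subr0 // => h /out h1.
  by rewrite /in_disc ltNge ltW.
have lim (x : R) : 0 <= x <= 1 -> tends (fun n => cycle_avg C n f x%:C) (f x%:C).
  by case/real_pt=> ox wx; rewrite -[f _]mul1r -wx; exact: discrete_cauchy_formula.
set B := M * _.
have bound n : (0 < n)%N ->
    mag (cycle_avg C n f 1%:C - \sum_(k <- s) k.1 * cycle_avg C n f k.2%:C) <= B.
  move=> n0.
  have -> : cycle_avg C n f 1%:C - \sum_(k <- s) k.1 * cycle_avg C n f k.2%:C =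
      \sum_(c <- C) c.1.1 * (cauchy_avg n c.1.2 c.2 f 1%:C -
        \sum_(k <- s) k.1 * cauchy_avg n c.1.2 c.2 f k.2%:C).
    rewrite /cycle_avg; under [X in _ - X]eq_bigr => k _ do rewrite mulr_sumr.
    rewrite exchange_big -sumrB; apply: eq_bigr => c _ /=.
    rewrite mulrBr mulr_sumr; congr (_ - _); apply: eq_bigr => k _; exact: mulrCA.
  apply: le_trans (mag_sum _ _ _) _; rewrite big_cons big_map /= mul1r.
  have hout : mag (cauchy_avg n 0 rho f 1%:C -
      \sum_(k <- s) k.1 * cauchy_avg n 0 rho f k.2%:C) <= M * rho * tau.
    apply: cauchy_avg_comb_le => // [|w]; first lra.
    rewrite subr0 => wr; split.
      apply: fM => [|h hL]; first by rewrite wr.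
      by have [_ hr] := H1 _ hL; have := mag_sub_le w h.1.1; lra.
    apply: s_far => t /andP [t0 t1].
    have := mag_sub_le w t%:C; rewrite wr magC ger0_norm //.
    by have := D_le1 m; lra.
  have hin h : h \in L' -> mag (-1 * (cauchy_avg n h.1.1 h.1.2 f 1%:C -
        \sum_(k <- s) k.1 * cauchy_avg n h.1.1 h.1.2 f k.2%:C)) <=
      M * tau * (h.1.2 / D h.2) +
      2 * M * (1 + Lam) * (if (m < h.2)%N then h.1.2 / D h.2 else 0).
    move=> hL; have [h0 _] := HL' _ hL; rewrite mulN1r magN.
    have Dh := D_gt0 h.2.
    have far_im w t : mag (w - h.1.1) = h.1.2 -> D h.2 / 2 <= mag (w - t%:C).
      move=> wh; apply: le_trans (@anchored_Im L' h w HL' W0' hL _) _; first by rewrite wh.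
      by have := Im_le_mag (w - t%:C); rewrite ImB /= subr0.
    have fMh w : mag (w - h.1.1) = h.1.2 -> mag (f w) <= M.
      by move=> /(on_disc _ _ hL) [h1 h2]; apply: fM => //; exact: ltW.
    have hD : h.1.2 <= h.1.2 / D h.2 by rewrite ler_pdivlMr // ler_piMr // ltW.
    (* Above level m the kernels are only known to be at most 2 / D on the circle; up to level m,
       [s_far] applies. *)
    have [mh|hm] := ltnP m h.2.
      apply: (@le_trans _ _ (M * h.1.2 * (2 * (1 + Lam) / D h.2))).
        apply: cauchy_avg_comb_le => // w wh; split; first exact: fMh.
        apply: le_trans (magB _ _) _; have d2 : 0 < D h.2 / 2 by rewrite divr_gt0.
        have k1 : mag (kernel_comb s w) <= Lam / (D h.2 / 2).
          by apply: kernel_comb_le => // k _; exact: far_im.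
        have k2 : mag (w - 1%:C)^-1 <= 1 / (D h.2 / 2).
          have := far_im w 1 wh => h1; rewrite magV div1r lef_pV2 ?posrE //.
          exact: lt_le_trans h1.
        have -> : 2 * (1 + Lam) / D h.2 = 1 / (D h.2 / 2) + Lam / (D h.2 / 2).
          by field; rewrite gt_eqF.
        by lra.
      have -> : M * h.1.2 * (2 * (1 + Lam) / D h.2) = 2 * M * (1 + Lam) * (h.1.2 / D h.2).
        by field; rewrite gt_eqF.
      by rewrite lerDr !mulr_ge0 // ?invr_ge0 ltW.
    rewrite mulr0 addr0; apply: (@le_trans _ _ (M * h.1.2 * tau)).
      apply: cauchy_avg_comb_le => // w wh; split; first exact: fMh.
      apply: s_far => t _; apply: le_trans (far_im w t wh).
      by have := D_mono hm; lra.
    by rewrite [X in X <= _]mulrAC ler_wpM2l // mulr_ge0.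
  have hsum : \sum_(h <- L') mag (-1 * (cauchy_avg n h.1.1 h.1.2 f 1%:C -
        \sum_(k <- s) k.1 * cauchy_avg n h.1.1 h.1.2 f k.2%:C)) <=
      M * tau * level_weight D L' 0 + 2 * M * (1 + Lam) * level_weight D L' m.+1.
    rewrite /level_weight [X in _ <= _ + _ * X]big_mkcond !mulr_sumr -big_split /=.
    rewrite big_seq [X in _ <= X]big_seq; apply: ler_sum => h; exact: hin.
  have w1 : 2 * M * (1 + Lam) * level_weight D L' m.+1 <= 2 * M * (1 + Lam) * cw.
    rewrite ler_wpM2l //; first by rewrite !mulr_ge0 // addr_ge0.
    exact: le_trans (H4 _) Wm.
  have Mt : 0 <= M * tau by rewrite mulr_ge0.
  have w2 : M * tau * level_weight D L' 0 <= M * tau * 1 by rewrite ler_wpM2l //; lra.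
  have w3 : M * rho * tau <= M * tau * 3 by rewrite mulrAC ler_wpM2l.
  by rewrite /B; lra.
(* The bound is uniform in n and passes to the limit. *)
have H := tends_add (lim 1 ltac:(rewrite ler01 lexx //))
  (tends_scale (-1) (@tends_sum _ _ s (fun k n => k.1 * cycle_avg C n f k.2%:C)
     (fun k => k.1 * f k.2%:C) _)).
apply/ler_addgt0Pr => e e0; have [|N HN] := H _ e e0.
  move=> k /s_nodes /andP [k0 k1]; apply: tends_scale; apply: lim.
  by apply/andP; split; lra.
pose T := f 1%:C - \sum_(k <- s) k.1 * f k.2%:C.
pose n := maxn 1 N.
pose U := cycle_avg C n f 1%:C - \sum_(k <- s) k.1 * cycle_avg C n f k.2%:C.
have h1 : mag (U - T) <= e by have := HN _ (leq_maxr 1 N); rewrite !mulN1r.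
have h2 : mag U <= B := bound _ (leq_maxl 1 N).
have h3 := mag_sub_le T U; rewrite mag_distC in h3.
by change (mag T <= B + e); lra.
Qed.

End SwissCheeseEstimate.

(** * Non-regularity of the Swiss cheese *)

Section SwissCheese.
Variables (R : realType) (H : nat -> nat -> seq (R[i] * R)) (D eps cc : nat -> R).

Definition cheese : set R[i] := [set z | mag z <= 4 /\ forall j, off_holes (H j) z].

Lemma cheese_closed : closed cheese.
Proof.
pose I := [set i : nat * nat * (R[i] * R) | i.2 \in H i.1.1 i.1.2].
rewrite (_ : cheese = [set z | mag (z - 0) <= 4] `&`
    \bigcap_(i in I) [set z | i.2.2 <= mag (z - i.2.1)]).
  apply: closedI; first exact: closed_mag_le.
  by apply: closed_bigI => i _; exact: closed_mag_ge.
apply/seteqP; split=> z /=; rewrite subr0 => -[z4 Hz]; split=> //.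
  by move=> [[j n] h] /= hH; exact: (Hz j n h hH).
by move=> j n h hH; exact: (Hz (j, n, h) hH).
Qed.

Lemma cheese_compact : compact cheese.
Proof.
by apply: subclosed_compact cheese_closed (@compact_disc R 4) _ => z [].
Qed.

Hypotheses (D_gt0 : forall l, 0 < D l) (D_mono : forall l m, (l <= m)%N -> D m <= D l)
  (D_le1 : forall l, D l <= 1).
Hypothesis H_hole : forall j n h, h \in H j n -> 0 < h.2 /\ D j <= `|Im h.1|.
Hypothesis H_sum : forall j n, \sum_(k < n) \sum_(h <- H j k) h.2 <= eps j.
Hypothesis eps_sum : forall m M, \sum_(m <= j < M) eps j / D j <= cc m.
Hypothesis cc_small : forall m, cc m <= 1 / 8.

(** The tail bound for a sum with the single term j. *)
Lemma eps_le j : eps j <= D j / 8.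
Proof.
have := le_trans (eps_sum j j.+1) (cc_small j); rewrite big_nat1 ler_pdivrMr //.
by rewrite mulrC mulrA mulr1.
Qed.

Lemma hole_small j n h : h \in H j n -> h.2 <= D j / 8.
Proof.
move=> hH; apply: le_trans (eps_le j); apply: le_trans (H_sum j n.+1).
have nn k : 0 <= \sum_(g <- H j k) g.2.
  by rewrite big_seq; apply: sumr_ge0 => g /H_hole [g0 _]; exact: ltW.
rewrite big_ord_recr /= -[X in X <= _]add0r lerD ?sumr_ge0 //.
rewrite (perm_big _ (perm_to_rem hH)) big_cons /= lerDl big_seq.
by apply: sumr_ge0 => g /mem_rem /H_hole [g0 _]; exact: ltW.
Qed.

Lemma cheese_real (x : R) : `|x| <= 4 -> cheese x%:C.
Proof.
move=> x4; split; first by rewrite magC.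
move=> j n h hH; have [_ Dh] := H_hole hH; have := hole_small hH.
have := Im_le_mag (x%:C - h.1); rewrite ImB /= sub0r normrN.
by have := D_gt0 j; lra.
Qed.

(** The level of a hole is the index of its family. *)
Definition hole_list N : seq (R[i] * R * nat) :=
  flatten [seq flatten [seq [seq (h.1, h.2, j) | h <- H j n] | n <- iota 0 N] | j <- iota 0 N].

Lemma hole_listP N k : reflect
  (exists j n h, [/\ (j < N)%N, (n < N)%N, h \in H j n & k = (h.1, h.2, j)])
  (k \in hole_list N).
Proof.
apply: (iffP flatten_mapP) => [[j jN /flatten_mapP [n nN /mapP [h hH ->]]]|].
  by exists j, n, h; rewrite mem_iota in jN; rewrite mem_iota in nN.
case=> j [n [h [jN nN hH ->]]]; exists j; rewrite ?mem_iota //.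
apply/flatten_mapP; exists n; rewrite ?mem_iota //.
by apply/mapP; exists h.
Qed.

Lemma hole_list_anchored N k : k \in hole_list N -> anchored D k.
Proof.
case/hole_listP=> j [n [h [_ _ hH ->]]]; have [h0 Dh] := H_hole hH.
by split=> //=; exists h.1 => //=; rewrite subrr mag0 ltW.
Qed.

Lemma hole_list_weight N m : level_weight D (hole_list N) m <= cc m.
Proof.
apply: le_trans (eps_sum m N).
rewrite (big_nat_widenl _ 0) //= big_mkcond /index_iota subn0.
rewrite /level_weight /hole_list big_flatten big_map; apply: ler_sum => j _.
rewrite big_flatten big_map; under eq_bigr => n _ do rewrite big_map /=.
case: (m <= j)%N; last by rewrite big1 // => n _; rewrite big_pred0_eq.
under eq_bigr => n _ do rewrite -mulr_suml.
rewrite -mulr_suml ler_pM2r ?invr_gt0 //; apply: le_trans (H_sum j N).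
by rewrite -[X in iota _ X]subn0 -/(index_iota 0 N) big_mkord.
Qed.

(** The points that satisfy the inequality or lie in a hole of [hole_list N] form open sets that
    increase with N and cover the disc; compactness selects one of them. *)
Lemma cheese_exhaustion (p q : {poly R[i]}) (M : R) : 0 <= M ->
  (forall z, cheese z -> mag p.[z] < M * mag q.[z]) ->
  exists N, forall z, mag z <= 4 -> ~~ has ((@in_disc R)^~ z) (hole_list N) ->
    mag p.[z] < M * mag q.[z].
Proof.
move=> M0 Hpq.
pose V N := [set z | mag p.[z] < M * mag q.[z]] `|`
  [set z | has ((@in_disc R)^~ z) (hole_list N)].
have [|||N HN] := @compact_exhaustion R _ V (@compact_disc R 4).
- move=> N; apply: openU; first exact: open_ratio_lt.
  rewrite openE => z /= /hasP [h hL]; rewrite /in_disc => zh.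
  apply/nbhs_magP; exists (h.1.2 - mag (z - h.1.1)); first by rewrite subr_gt0.
  move=> w wz /=; apply/hasP; exists h => //; rewrite /in_disc.
  by have := mag_triang z w h.1.1; lra.
- move=> m n mn z [h|/= /hasP [h /hole_listP [j [k [g [jm km gH hE]]]] zh]]; first by left.
  right; apply/hasP; exists h => //; apply/hole_listP; exists j, k, g.
  by split=> //; apply: leq_trans mn.
- move=> z /= z4; have [cz|ncz] := pselect (cheese z); first by exists 0; left; exact: Hpq.
  suff [j [n [h [hH zh]]]] : exists j n h, h \in H j n /\ mag (z - h.1) < h.2.
    exists (maxn j n).+1; right; apply/hasP; exists (h.1, h.2, j) => //.
    by apply/hole_listP; exists j, n, h; rewrite !ltnS leq_maxl leq_maxr.
  apply: contrapT => nh; apply: ncz; split=> // j n h hH.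
  by rewrite leNgt; apply/negP => zh; apply: nh; exists j, n, h.
exists N => z z4 nz; have [//|/= zh] := HN z z4.
by rewrite zh in nz.
Qed.

Hypothesis extrap : forall m, exists2 s : seq (R[i] * R),
  (forall k, k \in s -> 0 <= k.2 <= 1 / 2) &
  (forall w, far (D m / 4) w -> mag ((w - 1%:C)^-1 - kernel_comb s w) <= m.+1%:R^-1) /\
  (1 + \sum_(k <- s) mag k.1) * cc m.+1 <= m.+1%:R^-1.

Theorem cheese_not_regular : ~ regular_on cheese (RX cheese).
Proof.
pose F := [set x%:C | x in [set x : R | 0 <= x <= 1 / 2]].
move=> /(_ F 1%:C) [|||f /RX_rat_approx Hf [f1 fF]].
- rewrite (_ : F =
      ((@complex.Im R) @^-1` [set x | x <= 0] `&` (@complex.Im R) @^-1` [set x | 0 <= x]) `&`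
      ((@complex.Re R) @^-1` [set x | 0 <= x] `&` (@complex.Re R) @^-1` [set x | x <= 1 / 2])).
    have cR := @Re_continuous R; have cI := @Im_continuous R.
    by apply: closedI; apply: closedI; apply: preimage_closed => [? _|];
      [exact: cI|exact: closed_le|exact: cI|exact: closed_ge|
       exact: cR|exact: closed_ge|exact: cR|exact: closed_le].
  apply/seteqP; split=> [_ [x /andP [x0 x1] <-]|[a b] /= [[b0 b1] [a0 a1]]] //=.
  exists a; first by rewrite /= a0 a1.
  by have -> : b = 0 by apply/eqP; rewrite eq_le b0 b1.
- by move=> _ [x /andP [x0 x1] <-]; apply: cheese_real; rewrite ger0_norm; lra.
- split; first by apply: cheese_real; rewrite normr1; lra.
  by case=> x /andP [x0 x1] /complexI xE; lra.
have [M0 M00 fM] := rat_approx_bounded cheese_compact Hf.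
(* [M] bounds |p / q| for every approximant within 1 of f, so it can be fixed before [m], the nodes
   and the accuracy [sg]. *)
pose M := M0 + 2; have M_ge0 : 0 <= M by rewrite /M; lra.
(* The estimate will be M (4 + 2) / (m + 1), which this makes at most 1/4. *)
pose m := Num.bound (24 * M).
have mM : 6 * M * m.+1%:R^-1 <= 1 / 4.
  have h : 24 * M <= m.+1%:R.
    apply/ltW; apply: lt_le_trans (archi_boundP _) _; first lra.
    by rewrite ler_nat.
  by rewrite ler_pdivrMr //; lra.
have [s s_nodes [s_far s_cc]] := extrap m.
set Lam := \sum_(k <- s) mag k.1 in s_cc.
have Lam0 : 0 <= Lam by apply: sumr_ge0 => k _; exact: mag_ge0.
(* Since (1 + Lam) sg <= 1/4, the value at 1 has modulus at least 1 - sg and the combination at most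
   Lam sg; they differ by at least 3/4, against the estimate 1/4. *)
pose sg := Num.min 1 (1 / (4 * (1 + Lam))).
have L4 : 0 < 4 * (1 + Lam) by lra.
have sg0 : 0 < sg by rewrite lt_min ltr01 divr_gt0.
have sg1 : sg <= 1 by rewrite ge_min lexx.
have sgL : sg * (4 * (1 + Lam)) <= 1 by rewrite -ler_pdivlMr // ge_min lexx orbT.
have [p [q pq]] := Hf sg sg0.
have pqM z : cheese z -> mag p.[z] < M * mag q.[z].
  move=> cz; have [qz fz] := pq z cz; rewrite -ltr_pdivrMr ?mag_gt0 // -mag_div.
  have := mag_sub_le (p.[z] / q.[z]) (f z); rewrite mag_distC.
  by have := fM z cz; rewrite /M; lra.
have [N HN] := cheese_exhaustion M_ge0 pqM.
have t0 : 0 <= m.+1%:R^-1 :> R by rewrite invr_ge0.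
have w0 : level_weight D (hole_list N) 0 <= 1 / 8.
  exact: le_trans (hole_list_weight N 0) (cc_small 0).
have good z : mag z <= 4 -> ~~ has ((@in_disc R)^~ z) (hole_list N) ->
    q.[z] != 0 /\ mag (p.[z] / q.[z]) <= M.
  move=> z4 nz; have h := HN z z4 nz.
  have q0 : 0 < mag q.[z].
    rewrite lt_neqAle mag_ge0 andbT eq_sym; apply: contraTneq h => ->.
    by rewrite mulr0 -leNgt mag_ge0.
  by rewrite -mag_gt0 q0 mag_div ler_pdivrMr //; split=> //; exact: ltW.
have := @swiss_estimate R D D_gt0 D_mono D_le1 (hole_list N) p q M m.+1%:R^-1 (cc m.+1) m s
  (@hole_list_anchored N) w0 (hole_list_weight N _) M_ge0 t0 good s_nodes s_far.
rewrite -/Lam.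
set r1 := p.[1%:C] / _; set S := \sum_(k <- s) _ => est.
have S_le : mag S <= Lam * sg.
  apply: le_trans (mag_sum _ _ _) _; rewrite mulr_suml big_seq [X in _ <= X]big_seq.
  apply: ler_sum => k ks; rewrite magM ler_wpM2l ?mag_ge0 //.
  have /andP [k0 k1] := s_nodes _ ks.
  have cx : cheese k.2%:C by apply: cheese_real; rewrite ger0_norm; lra.
  have fx : f k.2%:C = 0 by apply: fF; exists k.2%:C => //; exists k.2 => //=; rewrite k0 k1.
  by have [_] := pq _ cx; rewrite fx sub0r magN => /ltW.
have r1_ge : 1 - sg <= mag r1.
  have c1 : cheese 1%:C by apply: cheese_real; rewrite normr1; lra.
  have [_] := pq _ c1; rewrite f1 -/r1.
  by have := mag_sub_le 1 r1; rewrite mag1; lra.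
have tr := mag_sub_le r1 S.
have bd : M * (4 * m.+1%:R^-1 + 2 * (1 + Lam) * cc m.+1) <= 6 * M * m.+1%:R^-1.
  have -> : 6 * M * m.+1%:R^-1 = M * (6 * m.+1%:R^-1) by ring.
  by rewrite ler_wpM2l //; move: (m.+1%:R^-1) (cc m.+1) s_cc => t c; lra.
have r1S := le_trans est (le_trans bd mM).
have : Lam * sg + sg <= 1 / 4 by lra.
by clear - tr r1S S_le r1_ge; lra.
Qed.

End SwissCheese.

(** * Hat functions and coloured squares *)

Section Hat.
Variable R : realType.

(** The classical recursion P + (t^2 - P^2) / 2 increases to |t| on [-1,1] with error at most |t| (1
    - |t| / 2)^n, and Bernoulli bounds this by 2 / n. *)
Lemma abs_poly_approx (B e : R) : 0 < B -> 0 < e ->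
  exists p : {poly R}, forall x : R, `|x| <= B -> `| `|x| - p.[x]| <= e.
Proof.
move=> B0 e0.
pose P := fix P n : {poly R} := if n is n'.+1 then P n' + 2^-1 *: ('X^2 - P n' ^+ 2) else 0.
have HP n t : `|t| <= 1 -> 0 <= (P n).[t] <= `|t| /\
    `|t| - (P n).[t] <= `|t| * (1 - `|t| / 2) ^+ n.
  move=> t1; have t0 := normr_ge0 t; elim: n => [|n [/andP [h1 h2] h3]] /=.
    by rewrite horner0 subr0 expr0 mulr1 !lexx t0.
  rewrite !hornerE -[t ^+ 2]real_normK ?num_real //.
  move: (`|t|) ((P n).[t]) t0 t1 h1 h2 h3 => a b a0 a1 b0 ba h.
  have E : a - (b + 2^-1 * (a ^+ 2 - b ^+ 2)) = (a - b) * (1 - (a + b) / 2) by field.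
  split.
    have : 0 <= (a - b) * (1 - (a + b) / 2) by rewrite mulr_ge0; lra.
    by rewrite -E => h4; apply/andP; split; [nra|lra].
  rewrite E exprSr mulrA; apply: le_trans (_ : (a - b) * (1 - a / 2) <= _).
    by rewrite ler_wpM2l //; lra.
  by rewrite ler_wpM2r //; lra.
pose n := (Num.bound (2 * B / e)).
have nB : 2 * B / e <= n%:R.
  by apply/ltW/archi_boundP; rewrite divr_ge0 ?ltW // mulr_gt0.
exists (B *: (P n \Po (B^-1 *: 'X))) => x xB.
rewrite hornerZ horner_comp hornerZ hornerX; set t := B^-1 * x.
have xE : `|x| = B * `|t| by rewrite /t normrM normfV (gtr0_norm B0) mulVKf ?gt_eqF.
have t1 : `|t| <= 1 by rewrite -(ler_pM2l B0) -xE mulr1.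
have [/andP [h1 h2] h3] := HP n t t1.
rewrite xE -mulrBr normrM (gtr0_norm B0) ger0_norm ?subr_ge0 //.
suff h : `|t| - (P n).[t] <= e / B by rewrite -ler_pdivlMl // mulrC.
apply: le_trans h3 _; rewrite ler_pdivlMr //.
have t0 := normr_ge0 t.
have := @bernoulli_expr R (1 - `|t| / 2) n; rewrite opprB addrCA subrr addr0.
move=> /(_ ltac:(by apply/andP; split; lra)).
have : 0 <= (1 - `|t| / 2) ^+ n by rewrite exprn_ge0 //; lra.
rewrite ler_pdivrMr // in nB.
move: (`|t|) (_ ^+ n) t0 => a y a0 y0 h.
have h4 : 2 * B * (a * y) <= n%:R * e * (a * y) by rewrite ler_wpM2r // mulr_ge0.
have h5 : e * (y * (1 + n%:R * (a / 2))) <= e * 1 by rewrite ler_wpM2l // ltW.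
have h6 : 0 <= e * y by rewrite mulr_ge0 // ltW.
by nra.
Qed.

(** The tent with peak 1 at y and support [y - d, y + d], written with absolute values so that
    [abs_poly_approx] applies. *)
Definition hat (y d x : R) : R := (`|x - (y + d)| + `|x - (y - d)| - 2 * `|x - y|) / (2 * d).

Lemma hat_top (y d : R) : 0 < d -> hat y d y = 1.
Proof.
move=> d0; rewrite /hat subrr normr0 mulr0 subr0 (_ : y - (y + d) = - d); last by ring.
by rewrite (_ : y - (y - d) = d) ?normrN ?gtr0_norm //; [field; rewrite gt_eqF|ring].
Qed.

Lemma hat_out (y d x : R) : 0 < d -> d <= `|x - y| -> hat y d x = 0.
Proof.
rewrite /hat => d0 h; have [s|s] := lerP 0 (x - y).
  have {}h : d <= x - y by rewrite -(ger0_norm s).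
  have -> : `|x - (y + d)| = x - (y + d) by apply: ger0_norm; lra.
  have -> : `|x - (y - d)| = x - (y - d) by apply: ger0_norm; lra.
  rewrite (ger0_norm s).
  by ring.
have {}h : d <= - (x - y) by rewrite -(ltr0_norm s).
have -> : `|x - (y + d)| = - (x - (y + d)) by apply: ler0_norm; lra.
have -> : `|x - (y - d)| = - (x - (y - d)) by apply: ler0_norm; lra.
rewrite (ltr0_norm s).
by ring.
Qed.

Lemma hat_poly_approx (y d B e : R) : 0 < d -> 0 < B -> 0 < e ->
  exists p : {poly R}, forall x : R, `|x| <= B -> `|hat y d x - p.[x]| <= e.
Proof.
move=> d0 B0 e0; pose B' := B + `|y| + d.
have B'0 : 0 < B' by rewrite /B' -addrA ltr_pwDl // addr_ge0 // ltW.
have ed : 0 < e * d / 2 by rewrite divr_gt0 // mulr_gt0.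
have [p Hp] := abs_poly_approx B'0 ed.
exists ((2 * d)^-1 *: ((p \Po ('X - (y + d)%:P)) + (p \Po ('X - (y - d)%:P)) -
  2 *: (p \Po ('X - y%:P)))) => x xB.
rewrite !hornerE !horner_comp !hornerE /hat mulrC -mulrBr normrM gtr0_norm; last first.
  by rewrite invr_gt0 mulr_gt0.
have hx (c : R) : `|c| <= `|y| + d -> `| `|x - c| - p.[x - c]| <= e * d / 2.
  by move=> hc; apply: Hp; apply: le_trans (ler_normB _ _) _; rewrite /B'; lra.
have h1 := hx (y + d); have h2 := hx (y - d); have h3 := hx y.
rewrite ler_pdivrMl ?mulr_gt0 //.
have {}h1 : `| `|x - (y + d)| - p.[x - (y + d)]| <= e * d / 2.
  by apply: h1; apply: le_trans (ler_normD _ _) _; rewrite (gtr0_norm d0).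
have {}h2 : `| `|x - (y - d)| - p.[x - (y - d)]| <= e * d / 2.
  by apply: h2; apply: le_trans (ler_normB _ _) _; rewrite (gtr0_norm d0).
have {}h3 : `| `|x - y| - p.[x - y]| <= e * d / 2 by apply: h3; lra.
move: h1 h2 h3; rewrite !ler_norml => /andP [? ?] /andP [? ?] /andP [? ?].
by apply/andP; split; lra.
Qed.

End Hat.

(** * Whitney squares of the real axis and their colouring *)

Section Bricks.
Variable R : realType.
Implicit Types (z w : R[i]) (m j : nat) (k : 'I_4).

Definition bh m : R := 2 / 2 ^+ m.

(** A square of side [bh m] at height [bh m] above the real axis, together with its mirror image.
    Columns are counted from Re z = -4, the left end of the disc |z| <= 4. *)
Definition brick m j z := (bh m <= `|Im z| <= 2 * bh m) &&
  (j%:R * bh m <= Re z + 4 <= j.+1%:R * bh m).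

(* Colouring the bricks by the parities of both indices makes any two bricks of
   the same colour lie at a distance comparable to their size. *)
Definition colour k m j := (odd m == odd k) && (odd j == (1 < k)%N).

Definition strip k : set R[i] :=
  [set z | Im z = 0 \/ exists m j, colour k m j && brick m j z].

Lemma bh_gt0 m : 0 < bh m. Proof. by rewrite divr_gt0 // exprn_gt0. Qed.

Lemma bhS m : bh m = 2 * bh m.+1.
Proof. by rewrite /bh exprS; field; rewrite expf_neq0 ?pnatr_eq0. Qed.

Lemma bh_mono m n : (m <= n)%N -> bh n <= bh m.
Proof.
by move=> mn; rewrite /bh ler_pM2l // lef_pV2 ?posrE ?exprn_gt0 // ler_weXn2l // ler1n.
Qed.

Lemma bh_le2 m : bh m <= 2.
Proof. by apply: le_trans (bh_mono (leq0n m)) _; rewrite /bh expr0 divr1. Qed.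

Lemma bh_small (e : R) : 0 < e -> exists m, bh m <= e.
Proof.
move=> e0; have [N HN] := @expr_small R (1 / 2) (e / 2) ltac:(lra) ltac:(lra).
by exists N; have := HN N (leqnn N); rewrite div1r exprVn /bh; lra.
Qed.

Lemma strip_cover z : mag z <= 4 -> exists k, strip k z.
Proof.
move=> z4; have [/eqP y0|y0] := boolP (Im z == 0); first by exists ord0; left.
have Y0 : 0 < `|Im z| by rewrite normr_gt0.
have Y4 : `|Im z| <= 4 := le_trans (Im_le_mag z) z4.
have [m /andP [m1 m2]] : exists m, bh m <= `|Im z| <= 2 * bh m.
  have ex : exists m, bh m <= `|Im z| := bh_small Y0.
  case: (ex_minnP ex) => m hm min; exists m; rewrite hm /=.
  case: m hm min => [|m] hm min; first by rewrite /bh expr0 divr1; lra.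
  by rewrite -bhS leNgt; apply/negP => /ltW /min; rewrite ltnn.
have X0 : 0 <= Re z + 4.
  by have := le_trans (Re_le_mag z) z4; rewrite ler_norml => /andP [? _]; lra.
have [j /andP [j1 j2]] : exists j, j%:R * bh m <= Re z + 4 <= j.+1%:R * bh m.
  have ex : exists j, Re z + 4 <= j.+1%:R * bh m.
    exists (Num.bound ((Re z + 4) / bh m)); rewrite -ler_pdivrMr ?bh_gt0 //.
    apply/ltW/(lt_le_trans (archi_boundP _)); last by rewrite ler_nat.
    by rewrite divr_ge0 // ltW ?bh_gt0.
  case: (ex_minnP ex) => j hj min; exists j; rewrite hj andbT.
  case: j hj min => [|j] hj min; first by rewrite mul0r.
  by rewrite leNgt; apply/negP => /ltW /min; rewrite ltnn.
(* The colour encodes the parity of the row in its first bit and that of the column in its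
   second. *)
have k4 : (odd m + 2 * odd j < 4)%N by case: (odd m); case: (odd j).
exists (Ordinal k4); right; exists m, j; rewrite /brick m1 m2 j1 j2 /colour /= !andbT.
by rewrite oddD oddM /= addbF; case: (odd m); case: (odd j).
Qed.

Lemma closed_brick m j : closed [set z | brick m j z].
Proof.
have cR := @Re_continuous R; have cI := @Im_continuous R.
have cN : continuous (fun z : R[i] => `|Im z|).
  by move=> z; apply: continuous_comp; [exact: cI|exact: norm_continuous].
rewrite (_ : [set z | _] =
  ((fun z => `|Im z|) @^-1` [set x | bh m <= x] `&`
   (fun z => `|Im z|) @^-1` [set x | x <= 2 * bh m]) `&`
  ((@complex.Re R) @^-1` [set x | j%:R * bh m - 4 <= x] `&`
   (@complex.Re R) @^-1` [set x | x <= j.+1%:R * bh m - 4])).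
  by apply: closedI; apply: closedI; apply: preimage_closed => [? _|];
    [exact: cN|exact: closed_ge|exact: cN|exact: closed_le|
     exact: cR|exact: closed_ge|exact: cR|exact: closed_le].
by apply/seteqP; split=> z; rewrite /brick /= !lerBlDr !lerBrDr;
  [case/andP=> /andP [? ?] /andP [? ?]|case=> -[-> ->] [-> ->]].
Qed.

Lemma closed_has (I : Type) (P : I -> R[i] -> bool) (s : seq I) :
  (forall i, closed [set z | P i z]) -> closed [set z | has (P^~ z) s].
Proof.
move=> H; elim: s => [|i s IH] /=.
  by rewrite (_ : [set z | _] = set0); [exact: closed0|apply/seteqP; split].
rewrite (_ : [set z | _] = [set z | P i z] `|` [set z | has (P^~ z) s]).
  exact: closedU.
by apply/seteqP; split=> z /=; [case/orP=> h; [left|right]|case=> ->; rewrite ?orbT].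
Qed.

Lemma brick_index m j z : mag z <= 4 -> brick m j z -> (j <= 4 * 2 ^ m)%N.
Proof.
move=> z4 /andP [_ /andP [h _]]; rewrite -(ler_nat R) -(ler_pM2r (bh_gt0 m)).
apply: le_trans h _; rewrite natrM natrX /bh.
have -> : 4 * 2 ^+ m * (2 / 2 ^+ m) = 8 :> R.
  by field; rewrite expf_neq0 ?pnatr_eq0.
by have := le_trans (Re_le_mag z) z4; rewrite ler_norml => /andP [_ ?]; lra.
Qed.

(** Bricks accumulate only at the real axis: for every M the set lies in the union of a thin band
    around the axis and finitely many bricks of rows below M, and it is the intersection of these
    closed sets with the disc. *)
Lemma closed_strip k : closed [set z | mag z <= 4 /\ strip k z].
Proof.
pose L M := [seq (m, j) | m <- iota 0 M, j <- iota 0 (4 * 2 ^ M).+1].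
pose P (i : nat * nat) z := colour k i.1 i.2 && brick i.1 i.2 z.
rewrite (_ : [set z | _] = [set z | mag (z - 0) <= 4] `&`
   \bigcap_(M in [set: nat]) ((@complex.Im R) @^-1` (Num.norm @^-1` [set x | x <= 2 * bh M]) `|`
      [set z | has (P^~ z) (L M)])).
  apply: closedI; first exact: closed_mag_le.
  apply: closed_bigI => M _; apply: closedU.
    apply: preimage_closed => [? _|]; first exact: Im_continuous.
    by apply: preimage_closed => [? _|]; [exact: norm_continuous|exact: closed_le].
  apply: closed_has => -[m j]; rewrite /P /=; case: (colour k m j) => /=.
    exact: closed_brick.
  by rewrite (_ : [set z | _] = set0); [exact: closed0|apply/seteqP; split].
apply/seteqP; split=> z /=; rewrite subr0 => -[z4 Hz]; split=> //.
  move=> M _; case: Hz => [y0|[m [j mj]]].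
    by left; rewrite /= y0 normr0 mulr_ge0 // ltW ?bh_gt0.
  have [Mm|mM] := leqP M m.
    left; case/andP: mj => _ /andP [/andP [_ h] _] /=; apply: le_trans h _.
    by rewrite ler_pM2l // bh_mono.
  right; apply/hasP; exists (m, j) => //; apply/allpairsP; exists (m, j).
  rewrite !mem_iota /=; split=> //; rewrite ltnS.
  case/andP: mj => _ /(brick_index z4) h; apply: leq_trans h _.
  by rewrite leq_mul2l /= leq_exp2l // ltnW.
have [y0|y0] := eqVneq (Im z) 0; [by left|right].
have y1 : 0 < `|Im z| by rewrite normr_gt0.
have [M hM] := @bh_small (`|Im z| / 4) ltac:(lra).
have := Hz M I; case=> [/= h|/hasP [[m j] _ h]]; last by exists m, j.
by have := bh_gt0 M; lra.
Qed.

End Bricks.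

(** * Regularity of the pieces *)

Section Pieces.
Variable R : realType.
Implicit Types (z w : R[i]) (m j : nat) (k : 'I_4) (X : set R[i]).

Definition brick_abs m j : R := (j%:R + 1 / 2) * bh R m - 4.

(* Centre of the half of the brick lying in the lower ([s]) or upper ([~~ s])
   half plane. *)
Definition brick_ctr m j (s : bool) : R[i] :=
  brick_abs m j +i* (if s then - (3 / 2 * bh R m) else 3 / 2 * bh R m).

Definition half_brick m j s z := brick m j z && ((Im z < 0) == s).

(** The half diagonal is 1 / sqrt 2 times the side. The rational bound 57/80 is 19/20 of 3/4, the
    radius used in [rat_approx_half_brick]. *)
Lemma half_brick_near m j s z : half_brick m j s z ->
  mag (z - brick_ctr m j s) <= 57 / 80 * bh R m.
Proof.
case/andP=> /andP [/andP [y1 y2] /andP [x1 x2]] /eqP sE.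
have h0 := bh_gt0 R m; rewrite -(natr1 j) in x2.
have p0 : 0 <= 57 / 80 * bh R m by lra.
rewrite -ler_sqr ?nnegrE ?mag_ge0 //.
rewrite mag_sqr ReB ImB /= /brick_abs.
have hx : (Re z - ((j%:R + 1 / 2) * bh R m - 4)) ^+ 2 <= (bh R m / 2) ^+ 2.
  rewrite -[X in X <= _]real_normK ?num_real // ler_sqr ?nnegrE //; last by lra.
  by rewrite ler_norml; apply/andP; split; lra.
have hy : (Im z - (if s then - (3 / 2 * bh R m) else 3 / 2 * bh R m)) ^+ 2 <= (bh R m / 2) ^+ 2.
  rewrite -[X in X <= _]real_normK ?num_real // ler_sqr ?nnegrE //; last by lra.
  rewrite ler_norml -sE; move: y1 y2; case: ltrP => y0 y1 y2.
    by rewrite (ltr0_norm y0) in y1 y2; apply/andP; split; lra.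
  by rewrite (ger0_norm y0) in y1 y2; apply/andP; split; lra.
by apply: le_trans (lerD hx hy) _; have := sqr_ge0 (bh R m); nra.
Qed.

Lemma brick_ctr_Im m j s z : 3 / 2 * bh R m - `|Im z| <= mag (z - brick_ctr m j s) /\
  `|Im z| - 3 / 2 * bh R m <= mag (z - brick_ctr m j s).
Proof.
have h0 := bh_gt0 R m.
have cE : `|Im (brick_ctr m j s)| = 3 / 2 * bh R m.
  have h1 : 0 < 3 / 2 * bh R m by lra.
  by rewrite /=; case: s; rewrite ?normrN gtr0_norm.
have h := Im_le_mag (z - brick_ctr m j s); rewrite ImB in h.
move: (Im (brick_ctr m j s)) cE h => c cE h.
by have := lerB_dist (Im z) c; have := lerB_dist c (Im z); rewrite (distrC c) cE; lra.
Qed.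

(** Equal parities make distinct rows differ by at least 2, which separates the imaginary parts; in
    one row the columns differ by at least 2, which separates the real parts. *)
Lemma brick_far k m j m' j' s z : colour k m j -> colour k m' j' -> brick m' j' z ->
  (m', j') != (m, j) -> bh R m <= mag (z - brick_ctr m j s).
Proof.
case/andP=> /eqP cm /eqP cj /andP [/eqP cm' /eqP cj'] /andP [/andP [y1 y2] /andP [x1 x2]] ne.
have h0 := bh_gt0 R m; have [i1 i2] := brick_ctr_Im m j s z.
case: (ltngtP m m') => mm.
- have m2 : (m.+2 <= m')%N by move: cm'; rewrite -cm => /(congr1 nat_of_bool); lia.
  have := bh_mono R m2; have := bhS R m; have := bhS R m.+1; lra.
- have m2 : (m'.+2 <= m)%N by move: cm'; rewrite -cm => /(congr1 nat_of_bool); lia.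
  have := bh_mono R m2; have := bhS R m'; have := bhS R m'.+1; lra.
have jj : j != j' by move: ne; rewrite mm xpair_eqE eqxx eq_sym.
subst m'; apply: le_trans (Re_le_mag _); rewrite ReB /= /brick_abs.
rewrite -(natr1 j') in x2.
have [j2|j2] : (j.+2 <= j')%N \/ (j'.+2 <= j)%N.
  by move: cj'; rewrite -cj => /(congr1 nat_of_bool); lia.
- have : (j%:R + 2) * bh R m <= j'%:R * bh R m.
    by rewrite ler_pM2r // -natrD ler_nat addn2.
  by move=> ?; apply: le_trans (ler_norm _); lra.
- have : (j'%:R + 2) * bh R m <= j%:R * bh R m.
    by rewrite ler_pM2r // -natrD ler_nat addn2.
  by move=> ?; rewrite distrC; apply: le_trans (ler_norm _); lra.
Qed.

Lemma half_brick_far k m j s z : colour k m j -> strip k z -> ~~ half_brick m j s z ->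
  bh R m <= mag (z - brick_ctr m j s).
Proof.
move=> cmj Sz nz; have h0 := bh_gt0 R m.
case: Sz => [y0|[m' [j' /andP [cmj' bz]]]].
  by have := (brick_ctr_Im m j s z).1; rewrite y0 normr0; lra.
have [[mE jE]|ne] := eqVneq (m', j') (m, j); last exact: brick_far cmj cmj' bz ne.
rewrite mE jE in bz; move: nz; rewrite /half_brick bz /= => sE.
apply: le_trans (Im_le_mag _); rewrite ImB /=.
case/andP: bz => /andP [y1 y2] _; move: y1 sE; case: ltrP => y0 y1; case: s => // _.
  by rewrite ltr0_norm //; rewrite ltr0_norm // in y1; lra.
by apply: le_trans (ler_norm _); rewrite ger0_norm // in y1; lra.
Qed.

(** A common point would be within 57/80 of the side from one centre and, by [brick_far], at least
    one side away from it. *)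
Lemma brick_unique k m j m' j' z : colour k m j -> colour k m' j' ->
  brick m j z -> brick m' j' z -> (m', j') = (m, j).
Proof.
move=> c c' b b'; apply/eqP/negPn/negP => ne.
have := brick_far (Im z < 0) c c' b' ne; have h0 := bh_gt0 R m.
have : half_brick m j (Im z < 0) z by rewrite /half_brick b eqxx.
by move/half_brick_near; lra.
Qed.

(** The circle of radius 3/4 of the side separates the square from the rest of the strip: |(z - q) /
    r| is at most 19/20 on the square and at least 4/3 elsewhere, so [gfac] converges to the
    indicator function. *)
Lemma rat_approx_half_brick X k m j s : X `<=` strip k -> colour k m j ->
  rat_approx X (fun z => (half_brick m j s z)%:R).
Proof.
move=> Xs cmj; apply: rat_approx_lim => e e0; have h0 := bh_gt0 R m.
pose e' := Num.min (1 / 2) (e / 2).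
have e'0 : 0 < e' by rewrite lt_min; apply/andP; split; lra.
have [N1 H1] := @expr_small R (19 / 20) e' ltac:(lra) e'0.
have [N2 H2] := @expr_small R (3 / 4) e' ltac:(lra) e'0.
pose n := maxn N1 N2; pose r : R := 3 / 4 * bh R m; have r0 : 0 < r by rewrite /r; lra.
have {}H1 : (19 / 20 : R) ^+ n <= e' := H1 n (leq_maxl _ _).
have {}H2 : (3 / 4 : R) ^+ n <= e' := H2 n (leq_maxr _ _).
pose q := brick_ctr m j s.
have mw z : mag ((z - q) / r%:C) = mag (z - q) / r by rewrite mag_div magC gtr0_norm.
have near z : half_brick m j s z -> mag ((z - q) / r%:C) ^+ n <= e'.
  move=> hz; apply: le_trans H1; apply: lerXn2r; rewrite ?nnegrE ?mag_ge0 //; first lra.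
  by rewrite mw ler_pdivrMr //; have := half_brick_near hz; rewrite -/q /r; lra.
have away z : X z -> ~~ half_brick m j s z -> (mag ((z - q) / r%:C) ^+ n)^-1 <= e'.
  move=> /Xs Sz hz; apply: le_trans H2; rewrite -exprVn.
  have far := half_brick_far cmj Sz hz; rewrite -/q in far.
  apply: lerXn2r; rewrite ?nnegrE ?invr_ge0 ?mag_ge0 //; first lra.
  rewrite mw invf_div ler_pdivrMr; last by lra.
  by rewrite /r; lra.
have both z : X z -> 1 - ((z - q) / r%:C) ^+ n != 0 /\
    mag ((half_brick m j s z)%:R - gfac q r n z) <= e.
  move=> Xz; have [hz|hz] := boolP (half_brick m j s z).
    have := near z hz; rewrite le_min => /andP [h1 h2].
    by have [? h3] := gfac_near1 h1; split=> //; rewrite mag_distC; apply: le_trans h3 _; lra.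
  have := away z Xz hz; rewrite le_min => /andP [h1 h2].
  have p0 : 0 < mag ((z - q) / r%:C) ^+ n.
    have far := half_brick_far cmj (Xs _ Xz) hz.
    by rewrite exprn_gt0 // mw divr_gt0 //; lra.
  have h3 : 2 <= mag ((z - q) / r%:C) ^+ n.
    by move: h1; rewrite -[_^-1]div1r ler_pdivrMr //; lra.
  by have [? h4] := gfac_near0 h3; split=> //; rewrite sub0r magN; apply: le_trans h4 _; lra.
exists (gfac q r n) => [|z /both []//].
apply: (@rat_approx_ext _ _ _ (fun z => (1 : {poly R[i]}).[z] / (gfac_poly q r n).[z])).
  by move=> z _; rewrite hornerC div1r gfac_polyE.
apply: rat_approx_rat => z /both [+ _]; rewrite /gfac_poly !hornerE //.
Qed.

(** * Hat functions continued by constants on the squares *)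

Section Bump.
Variables (k : 'I_4) (y d : R) (M0 : nat).
Hypothesis d0 : 0 < d.

(** The large bricks, in rows below [M0], get the value 0, so that the support stays near y. *)
Definition brick_value m j : R := if (m < M0)%N then 0 else hat y d (brick_abs m j).

(* By [brick_unique] the index picked by [xget] does not depend on choices. *)
Definition bump z : R := if Im z == 0 then hat y d (Re z) else
  let mj := xget (0, 0)%N [set mj | colour k mj.1 mj.2 && brick mj.1 mj.2 z] in
  brick_value mj.1 mj.2.

Lemma brick_Im_neq0 m j z : brick m j z -> (Im z == 0) = false.
Proof.
case/andP=> /andP [h _] _; apply/eqP => y0.
by rewrite y0 normr0 in h; have := bh_gt0 R m; lra.
Qed.

Lemma bump_real z : Im z = 0 -> bump z = hat y d (Re z).
Proof. by move=> h; rewrite /bump h eqxx. Qed.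

Lemma bump_brick m j z : colour k m j -> brick m j z -> bump z = brick_value m j.
Proof.
move=> c b; rewrite /bump (brick_Im_neq0 b) /=.
have := @xgetPex _ (0, 0)%N [set mj | colour k mj.1 mj.2 && brick mj.1 mj.2 z]
  (ex_intro _ (m, j) (introT andP (conj c b))).
case: (xget _ _) => m' j' /= /andP [c' b'].
by have [-> ->] := brick_unique c c' b b'.
Qed.

Lemma brick_abs_near m j z : brick m j z -> `|Re z - brick_abs m j| <= bh R m / 2.
Proof.
case/andP=> _ /andP [x1 x2]; rewrite -(natr1 j) in x2; rewrite /brick_abs.
by rewrite ler_norml; apply/andP; split; lra.
Qed.

Lemma brick_near m j z : brick m j z -> mag (z - (brick_abs m j)%:C) <= 3 * bh R m.
Proof.
move=> b; apply: le_trans (mag_le_ReIm _) _; rewrite ReB ImB /= subr0.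
have := brick_abs_near b; case/andP: b => /andP [_ h] _.
by have := bh_gt0 R m; lra.
Qed.

(** A polynomial P close to the hat on the real axis is corrected on the finitely many bricks of
    rows below M by multiples of their indicator functions. Smaller bricks are so close to the axis
    that P is already close to the constant there. *)
Lemma rat_approx_bump X : X `<=` strip k -> (forall z, X z -> mag z <= 4) -> compact X ->
  rat_approx X (fun z => (bump z)%:C).
Proof.
move=> Xs X4 cX; apply: rat_approx_lim => e e0.
have e2 : 0 < e / 2 by rewrite divr_gt0.
(* The bound 5 leaves room for centres of bricks that stick out of |Re z| <= 4 by at most 1. *)
have [p0 Hp0] := @hat_poly_approx R y d 5 (e / 2) d0 ltac:(lra) e2.
pose P := map_poly (real_complex R) p0.
have HP (x : R) : `|x| <= 5 -> mag ((hat y d x)%:C - P.[x%:C]) <= e / 2.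
  by move=> x5; rewrite /P horner_map -rmorphB magC; exact: Hp0.
have [L L0 HL] := @horner_lipschitz R P 5 ltac:(lra).
(* A brick of side h is within 3 h of its abscissa, so P varies by at most 3 L h <= e / 2. *)
have eL : 0 < e / (6 * (L + 1)) by rewrite divr_gt0 // mulr_gt0 // ltr_wpDl.
have [M1 hM1] := @bh_small R _ eL.
pose M := maxn M0 M1; have [J hJ] : exists J, (4 * 2 ^ M < J)%N by exists (4 * 2 ^ M).+1.
pose I := [seq (mj, s) | mj <- [seq (m, j) | m <- iota 0 M, j <- iota 0 J], s <- [:: true; false]].
pose T (i : nat * nat * bool) z : R[i] := if colour k i.1.1 i.1.2 then
  ((brick_value i.1.1 i.1.2)%:C - P.[z]) * (half_brick i.1.1 i.1.2 i.2 z)%:R else 0.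
exists (fun z => P.[z] + \sum_(i <- I) T i z).
  apply: rat_approx_add; first exact: rat_approx_poly.
  apply: rat_approx_sum => -[[m j] s]; rewrite /T /=.
  case c : (colour k m j); last exact: rat_approx_cst.
  apply: rat_approx_mul => //; last exact: (rat_approx_half_brick _ Xs c).
  apply: rat_approx_add; first exact: rat_approx_cst.
  apply: (rat_approx_ext _ (rat_approx_poly X (- P))) => z _; exact: esym (hornerN _ _).
have uI : uniq I.
  have up (A B : eqType) (s : seq A) (t : seq B) : uniq s -> uniq t ->
      uniq [seq (a, b) | a <- s, b <- t].
    move=> us ut; apply: allpairs_uniq => //. by move=> [a b] [a' b'].
  by apply: (up _ _ _ [:: true; false]) => //; apply: up; exact: iota_uniq.
move=> z Xz; have z4 := X4 z Xz; have Sz := Xs z Xz.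
have z5 : mag z <= 5 by lra.
have Rez : `|Re z| <= 4 := le_trans (Re_le_mag z) z4.
case: Sz => [y0|[m [j /andP [c b]]]].
  rewrite big1 => [|[[m j] s] _]; last first.
    rewrite /T /=; case: ifP => // _; have [/andP [/brick_Im_neq0]|] := boolP (half_brick m j s z).
      by rewrite y0 eqxx.
    by rewrite mulr0.
  rewrite addr0 bump_real //.
  have zE : z = (Re z)%:C by case: z y0 {Xz z4 z5 Rez} => a b /= ->.
  by rewrite {2}zE; apply: le_trans (HP (Re z) _) _; lra.
rewrite (bump_brick c b).
have T0 i : i \in I -> i != (m, j, (Im z < 0)) -> T i z = 0.
  case: i => -[m' j'] s _ ne; rewrite /T /=; case: ifP => // c'.
  have [/andP [b' /eqP sE]|] := boolP (half_brick m' j' s z); last by rewrite mulr0.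
  by move: ne; rewrite (brick_unique c c' b b') sE eqxx.
have [mM|Mm] := ltnP m M.
  have iI : (m, j, (Im z < 0)) \in I.
    apply/allpairsP; exists ((m, j), (Im z < 0)); split=> //; last by case: (_ < _).
    apply/allpairsP; exists (m, j); rewrite !mem_iota; split=> //.
    rewrite /=; apply: leq_ltn_trans hJ; apply: leq_trans (brick_index z4 b) _.
    by rewrite leq_mul2l /= leq_exp2l // ltnW.
  rewrite (bigD1_seq _ iI uI) /= big_seq_cond big1 => [|i /andP [iI' ne]]; last exact: T0.
  by rewrite /T /= c /half_brick b eqxx /= mulr1 addr0 [P.[z] + _]addrC subrK subrr mag0 ltW.
rewrite big_seq big1 => [|i iI]; last first.
  apply: T0 => //; apply/eqP => iE; move: iI; rewrite iE.
  move=> /allpairsP [[mj s] /= [h _ [mE _]]].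
  move: h; rewrite -mE => /allpairsP [[m' j'] /= [h _ [mE' _]]].
  by move: h; rewrite -mE' mem_iota /= add0n ltnNge Mm.
rewrite addr0 /brick_value ltnNge (leq_trans (leq_maxl _ _) Mm) /=.
have hx := brick_abs_near b; have hz := brick_near b; have b2 := bh_le2 R m.
have x5 : `|brick_abs m j| <= 5.
  by have := lerB_dist (brick_abs m j) (Re z); rewrite distrC; lra.
have xc5 : mag (brick_abs m j)%:C <= 5 by rewrite magC.
have [_ hl] := HL _ _ z5 xc5.
have hm : bh R m <= e / (6 * (L + 1)).
  by apply: le_trans (bh_mono R _) hM1; apply: leq_trans (leq_maxr _ _) Mm.
rewrite ler_pdivlMr ?mulr_gt0 ?ltr_wpDl // in hm.
have h1 : L * mag ((brick_abs m j)%:C - z) <= e / 2.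
  rewrite mag_distC; apply: le_trans (_ : L * (3 * bh R m) <= _); first by rewrite ler_wpM2l.
  by have := bh_gt0 R m; nra.
by have := mag_triang P.[(brick_abs m j)%:C] (hat y d (brick_abs m j))%:C P.[z];
   have := HP _ x5; lra.
Qed.

End Bump.

(** At points off the real axis the given functions are normalised; at real points [bump] does the
    work. *)
Theorem piece_regular X k : compact X -> (forall z, X z -> mag z <= 4) -> X `<=` strip k ->
  (forall z (e : R), X z -> Im z != 0 -> 0 < e -> exists2 f, rat_approx X f &
    f z != 0 /\ forall w, X w -> e <= mag (w - z) -> f w = 0) ->
  regular_on X (RX X).
Proof.
move=> cX X4 Xs bumps F y Fc FX [Xy nFy].
have [d d0 Hd] : exists2 d : R, 0 < d & forall w, F w -> d <= mag (w - y).
  have : nbhs y (~` F) by apply: open_nbhs_nbhs; split; [exact: closed_openC|].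
  case/nbhs_magP => d d0 Hd; exists d => // w Fw; rewrite leNgt; apply/negP => /Hd.
  exact.
have [y0|y0] := eqVneq (Im y) 0; last first.
  have [f Hf [fy fF]] := bumps y d Xy y0 d0.
  exists (fun z => f z * (f y)^-1).
    by apply/rat_approx_RX/rat_approx_mul => //; exact: rat_approx_cst.
  split; first by rewrite divff.
  by move=> _ [w Fw <-] /=; rewrite fF ?mul0r //; [exact: FX|exact: Hd].
have d3 : 0 < d / 3 by rewrite divr_gt0.
(* Bricks of rows from [M0] on are within d / 2 of their abscissa; if such a brick meets F, its
   abscissa is at least d / 2 from y and the hat of half-width d / 3 vanishes there. *)
have [M0 hM0] := @bh_small R (d / 6) ltac:(lra).
exists (fun z => (bump k (Re y) (d / 3) M0 z)%:C).
  by apply/rat_approx_RX/rat_approx_bump.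
have yE : y = (Re y)%:C by case: (y) y0 => a b /= ->.
split; first by rewrite bump_real // hat_top.
move=> _ [w Fw <-] /=; have dw := Hd w Fw.
suff -> : bump k (Re y) (d / 3) M0 w = 0 by [].
case: (Xs w (FX w Fw)) => [w0|[m [j /andP [c b]]]].
  rewrite bump_real // hat_out //; move: dw; rewrite {1}yE.
  have -> : w = (Re w)%:C by case: (w) w0 => a b /= ->.
  by rewrite -rmorphB magC /=; lra.
rewrite (bump_brick _ _ _ c b) /brick_value; case: ltnP => // Mm.
apply: hat_out => //; have hb := brick_near b; have hm := bh_mono R Mm.
have := mag_triang (brick_abs m j)%:C w y; rewrite {2}yE -rmorphB magC.
by lra.
Qed.

End Pieces.

(** * Choice of the holes *)

Section ChoiceOfHoles.
Variable R : realType.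

Fixpoint running_min (u : nat -> R) n : R :=
  if n is n'.+1 then Num.min (running_min u n') (u n) else u 0%N.

Lemma running_min_mono u m n : (m <= n)%N -> running_min u n <= running_min u m.
Proof.
move/subnK <-; elim: (n - m)%N => //= k IH; apply: le_trans IH.
by rewrite ge_min lexx.
Qed.

Lemma running_min_le u m n : (m <= n)%N -> running_min u n <= u m.
Proof.
move/(running_min_mono u)/le_trans; apply.
by case: m => [|m] //=; rewrite ge_min lexx orbT.
Qed.

Lemma running_min_gt0 u n : (forall m, 0 < u m) -> 0 < running_min u n.
Proof. by move=> u0; elim: n => //= n IH; rewrite lt_min IH u0. Qed.

Lemma half_sum m M : \sum_(m <= j < M) (1 / 2) ^+ j.+1 <= 1 - (1 / 2) ^+ M :> R.
Proof.
elim: M => [|M IH]; first by rewrite big_geq // expr0 subrr.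
have [mM|Mm] := leqP m M; last first.
  by rewrite big_geq // subr_ge0 exprn_ile1 //; lra.
by rewrite big_nat_recr //= exprS; have := IH; lra.
Qed.

(** Codes of rational centres and radii 1 / (n + 1) are decoded; a disc whose double meets the real
    axis is replaced by a fixed admissible one. *)
Definition nth_disc j : R[i] * R :=
  let dflt := (0 +i* 2, 1 / 2) in
  if unpickle j is Some (a, b, n) then
    let r : R := n.+1%:R^-1 in
    if 2 * r < `|ratr b| then ((ratr a : R) +i* ratr b, r) else dflt
  else dflt.

Lemma nth_discP j : 0 < (nth_disc j).2 <= 1 /\ 2 * (nth_disc j).2 < `|Im (nth_disc j).1|.
Proof.
have dflt : 0 < (1 / 2 : R) <= 1 /\ 2 * (1 / 2) < `|Im (0 +i* 2 : R[i])|.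
  by rewrite /= ger0_norm //; split; [apply/andP; split|]; lra.
rewrite /nth_disc; case: unpickle => // -[[a b] n]; case: ifP => // h; split=> //=.
by rewrite invr_gt0 ltr0n /= invf_le1 ?ltr0n // ler1n.
Qed.

Lemma nth_disc_dense (y : R[i]) (e : R) : Im y != 0 -> 0 < e ->
  exists j, mag (y - (nth_disc j).1) <= (nth_disc j).2 / 2 /\ 2 * (nth_disc j).2 <= e.
Proof.
move=> y0 e0; have y1 : 0 < `|Im y| by rewrite normr_gt0.
(* The second bound makes the disc admissible: |b| >= |Im y| - r / 4 >= 4 r - r / 4 > 2 r. *)
pose t := Num.min (e / 2) (`|Im y| / 4).
have t0 : 0 < t by rewrite lt_min; apply/andP; split; lra.
pose n := Num.bound t^-1; pose r : R := n.+1%:R^-1.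
have r0 : 0 < r by rewrite invr_gt0.
have rt : r <= t.
  rewrite -[t]invrK lef_pV2 ?posrE ?invr_gt0 ?ltr0n //; apply/ltW.
  by apply: lt_le_trans (archi_boundP _) _; rewrite ?ler_nat // invr_ge0 ltW.
have [te ty] : t <= e / 2 /\ t <= `|Im y| / 4 by rewrite !ge_min !lexx orbT.
have [a] := @rat_in_itvoo R (Re y - r / 4) (Re y + r / 4) ltac:(lra).
rewrite in_itv /= => /andP [a1 a2].
have [b] := @rat_in_itvoo R (Im y - r / 4) (Im y + r / 4) ltac:(lra).
rewrite in_itv /= => /andP [b1 b2].
have ha : `|Re y - ratr a| <= r / 4 by rewrite ler_norml; apply/andP; split; lra.
have hb : `|Im y - ratr b| <= r / 4 by rewrite ler_norml; apply/andP; split; lra.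
have ok : 2 * r < `|ratr b : R|.
  by have := lerB_dist (Im y) (ratr b); lra.
exists (pickle (a, b, n)); rewrite /nth_disc pickleK -/r ok /=; split; last by lra.
by apply: le_trans (mag_le_ReIm _) _; rewrite ReB ImB /=; lra.
Qed.

(** Hole centres of family j are within one radius of a point more than two radii from the real
    axis, so the radius bounds their distance to the axis from below; the running minimum makes the
    bound monotone in j. *)
Definition disc_dist := running_min (fun j => (nth_disc j).2).

Lemma disc_dist_gt0 j : 0 < disc_dist j.
Proof. by apply: running_min_gt0 => m; have [/andP []] := nth_discP m. Qed.

Lemma disc_dist_le1 j : disc_dist j <= 1.
Proof.
by apply: le_trans (running_min_le _ (leqnn j)) _; have [/andP []] := nth_discP j.
Qed.

(* The radii of the [j]-th family of holes must be small compared with the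
   extrapolation constants of all the previous levels. *)
Lemma hole_budget : exists eps cc : nat -> R,
  [/\ forall j, 0 < eps j,
      forall m M, \sum_(m <= j < M) eps j / disc_dist j <= cc m,
      forall m, cc m <= 1 / 8
    & forall m, exists2 s : seq (R[i] * R),
        (forall k, k \in s -> 0 <= k.2 <= 1 / 2) &
        (forall w, far (disc_dist m / 4) w ->
           mag ((w - 1%:C)^-1 - kernel_comb s w) <= m.+1%:R^-1) /\
        (1 + \sum_(k <- s) mag k.1) * cc m.+1 <= m.+1%:R^-1].
Proof.
have ext m : exists s : seq (R[i] * R), (forall k, k \in s -> 0 <= k.2 <= 1 / 2) /\
    (forall w, far (disc_dist m / 4) w ->
       mag ((w - 1%:C)^-1 - kernel_comb s w) <= m.+1%:R^-1).
  have d4 : 0 < disc_dist m / 4 by rewrite divr_gt0 // disc_dist_gt0.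
  have m0 : 0 < m.+1%:R^-1 :> R by rewrite invr_gt0 ltr0n.
  by have [s s1 s2] := kernel_extrapolation d4 m0; exists s.
have [s Hs] := choice ext.
pose Lam m := 1 + \sum_(k <- s m) mag k.1.
have Lam0 m : 0 < Lam m.
  by rewrite ltr_pwDl // sumr_ge0 // => k _; exact: mag_ge0.
(* [cc m.+1] depends on the coefficients of level m, hence on [disc_dist m] only, so there is no
   circularity with [eps]. *)
pose cc m := if m is m'.+1 then Num.min (1 / 8) (m'.+1%:R^-1 / Lam m') else 1 / 8.
have cc0 m : 0 < cc m.
  by case: m => [|m] /=; rewrite ?lt_min ?divr_gt0 // ?invr_gt0 ?ltr0n.
have cc8 m : cc m <= 1 / 8 by case: m => [|m] /=; rewrite ?ge_min lexx.
(* The running minimum puts term j below [cc m] for every m <= j, and the powers of 1/2 make the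
   tails summable. *)
pose eps j := disc_dist j * ((1 / 2) ^+ j.+1 * running_min cc j).
exists eps, cc; split=> //.
- by move=> j; rewrite !mulr_gt0 ?disc_dist_gt0 ?exprn_gt0 ?running_min_gt0 //; lra.
- move=> m M; apply: (@le_trans _ _ (\sum_(m <= j < M) (1 / 2) ^+ j.+1 * cc m)).
    rewrite big_nat [X in _ <= X]big_nat; apply: ler_sum => j /andP [mj _].
    rewrite /eps mulrC mulKf ?gt_eqF ?disc_dist_gt0 // ler_wpM2l ?running_min_le //.
    by rewrite exprn_ge0 //; lra.
  rewrite -mulr_suml -[X in _ <= X]mul1r ler_pM2r //; apply: le_trans (half_sum m M) _.
  by rewrite gerBl exprn_ge0 //; lra.
- move=> m; have [s1 s2] := Hs m; exists (s m) => //; split=> //=.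
  by rewrite mulrC -(ler_pdivlMr _ _ (Lam0 m)) ge_min lexx orbT.
Qed.

End ChoiceOfHoles.

Theorem theorem6 (R : realType) :
  exists (X : set R[i]) (Xs : 'I_4 -> set R[i]),
    [/\ compact_plane_set X,
        forall k : 'I_4, compact_plane_set (Xs k),
        X = \bigcup_(k in [set: 'I_4]) Xs k,
        forall k : 'I_4, regular_on (Xs k) (RX (Xs k))
      & ~ regular_on X (RX X)].
Proof.
have [eps [cc [eps0 eps_sum cc8 extrap]]] := hole_budget R.
have [H HH] := choice (fun j => mckissick (nth_disc R j).1
  (andP (nth_discP R j).1).1 (eps0 j)).
have H_hole j n h : h \in H j n -> (0 < h.2) /\ (disc_dist R j <= `|Im h.1|).
  have [Hc _ _] := HH j; move=> /Hc [hc h0]; split=> //.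
  have [_ Imc] := nth_discP R j; have := Im_le_mag (h.1 - (nth_disc R j).1).
  rewrite ImB; have := lerB_dist (Im (nth_disc R j).1) (Im h.1); rewrite distrC.
  have : (disc_dist R j <= (nth_disc R j).2) by apply: running_min_le.
  by have [/andP [? _] _] := nth_discP R j; lra.
have H_sum j n : (\sum_(k < n) \sum_(h <- H j k) h.2 <= eps j) by have [_ + _] := HH j; exact.
have D_gt0 := @disc_dist_gt0 R; have D_le1 := @disc_dist_le1 R.
have D_mono l m : (l <= m)%N -> (disc_dist R m <= disc_dist R l).
  exact: running_min_mono.
pose X := cheese H; pose Xs k := X `&` strip k.
have X4 z : X z -> (mag z <= 4) by case.
have X0 : X 0%:C.
  by apply: cheese_real D_gt0 H_hole H_sum eps_sum cc8 _ _; rewrite normr0.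
have Xs_compact k : compact (Xs k).
  have E : Xs k = cheese H `&` [set z | (mag z <= 4) /\ strip k z].
    by apply/seteqP; split=> z [Xz] => [Sz|[]] //; split=> //; split=> //; exact: X4.
  apply: (subclosed_compact _ (@compact_disc R 4)) => [|z [/X4]] //.
  by rewrite E; apply: closedI; [exact: cheese_closed|exact: closed_strip].
exists X, Xs; split.
- by split; [exists 0%:C|exact: cheese_compact].
- by move=> k; split=> //; exists 0%:C; split=> //; left.
- apply/seteqP; split=> [z Xz|z [k _ []] //].
  by have [k Sz] := strip_cover (X4 z Xz); exists k.
- move=> k; apply: (@piece_regular _ (Xs k) k (Xs_compact k)).
  + by move=> z [/X4].
  + by move=> z [].
  move=> z e [Xz _] y0 e0.
  (* The point z lies in the concentric half of disc j, so the function of family j is nonzero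
     there; points at distance e >= 2 r from z are outside the disc, where it vanishes. *)
  have [j [zj je]] := nth_disc_dense y0 e0.
  have [_ _ [f [fX f0 fn0]]] := HH j.
  exists f; first by apply: fX => w [[_ Hw] _]; exact: Hw.
  split; first by apply: fn0 => //; case: Xz => _; exact.
  move=> w [[_ Hw] _] ew; apply: f0; first exact: Hw.
  have := mag_triang (nth_disc R j).1 w z; rewrite (mag_distC (nth_disc R j).1 z).
  by have [/andP [? _] _] := nth_discP R j; lra.
- exact: cheese_not_regular D_gt0 D_mono D_le1 H_hole H_sum eps_sum cc8 extrap.
Qed.
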